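(* Let $\mathcal{F}$ be a class of graphs such that (i) there is a polynomial-time algorithm that, given a graph $G=(V,E)$, either correctly decides that $G$ is $\mathcal{F}$-free or outputs $S\subseteq V$ with $G[S]\in\mathcal{F}$; (ii) $\alpha^*:=\max_{H\in\mathcal{F}}\alpha(H)$ is bounded (finite); and (iii) Weighted Vertex Cover can be solved exactly in polynomial time on $\mathcal{F}$-free graphs. Let $\mathrm{OPT}_\mathcal{P}(G,w)$ denote the minimum weight of a modulator to the class of $\mathcal{F}$-free graphs. Then there is a polynomial-time algorithm that, given a graph $G=(V,E)$ with weight function $w\colon V\to\mathbb{Q}_{\ge0}$, finds a vertex cover of weight at most $\mathrm{OPT}_{\mathrm{WVC}}(G,w)+\alpha^*\,\mathrm{OPT}_\mathcal{P}(G,w)$.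
   Context: A graph is $\mathcal{F}$-free if it contains no graph of $\mathcal{F}$ as an induced subgraph. $\alpha(H)$ is the independence number of $H$. A vertex cover of $G$ is a set $X\subseteq V$ such that $G-X$ is edgeless; $w(X)=\sum_{x\in X}w(x)$ and $\mathrm{OPT}_{\mathrm{WVC}}(G,w)$ is the minimum weight of a vertex cover. A modulator to a graph class $\mathcal{C}$ is a set $M\subseteq V$ with $G-M\in\mathcal{C}$; its weight is $w(M)$. *)

(* Defs.v *)
From HB Require Import structures.
From mathcomp Require Import all_boot all_order all_algebra.
Set Implicit Arguments.
Unset Strict Implicit.
Unset Printing Implicit Defensive.
Import Order.TTheory GRing.Theory Num.Theory.

Record sgraph := SGraph {
  vertex :> finType;
  edge : rel vertex;
  edge_sym : symmetric edge;
  edge_irr : irreflexive edge }.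

Section Induced.
Variables (G : sgraph) (S : {set G}).

Definition induced_edge : rel {x : G | x \in S} :=
  fun x y => edge (val x) (val y).

Lemma induced_edge_sym : symmetric induced_edge.
Proof. by move=> x y; exact: edge_sym. Qed.

Lemma induced_edge_irr : irreflexive induced_edge.
Proof. by move=> x; exact: edge_irr. Qed.

Definition induced : sgraph := SGraph induced_edge_sym induced_edge_irr.
End Induced.

Definition remove (G : sgraph) (X : {set G}) : sgraph := induced (~: X).

Definition giso (G H : sgraph) : Prop :=
  exists2 f : G -> H, bijective f & forall x y, edge (f x) (f y) = edge x y.

(** Graph classes are arbitrary predicates; membership of a concrete graph is
    read up to isomorphism, so a class need not be isomorphism-closed. *)
Definition in_class (F : sgraph -> Prop) (G : sgraph) : Prop :=
  exists2 H, F H & giso G H.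

Definition is_free (F : sgraph -> Prop) (G : sgraph) : Prop :=
  forall S : {set G}, ~ in_class F (induced S).

Definition edgeless (G : sgraph) : bool :=
  [forall x : G, forall y : G, ~~ edge x y].

Definition independence_number (G : sgraph) : nat :=
  \max_(S : {set G} | edgeless (induced S)) #|S|.

(** The empty class is given maximum 0. *)
Definition is_max_independence (F : sgraph -> Prop) (a : nat) : Prop :=
  (forall H, F H -> independence_number H <= a) /\
  ((exists2 H, F H & independence_number H = a) \/
   ((forall H, ~ F H) /\ a = 0)).

Definition vertex_cover (G : sgraph) (X : {set G}) : bool :=
  edgeless (remove X).

Definition modulator (F : sgraph -> Prop) (G : sgraph) (M : {set G}) : Prop :=
  is_free F (remove M).

Record wgraph := WGraph {
  wg_graph :> sgraph;
  weight : wg_graph -> rat;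
  weight_ge0 : forall x, (0 <= weight x)%R }.

Definition set_weight (I : wgraph) (X : {set I}) : rat :=
  (\sum_(x in X) weight x)%R.

Definition is_min_weight (I : wgraph) (P : {set I} -> Prop) (o : rat) : Prop :=
  (exists2 X, P X & set_weight X = o) /\
  (forall X, P X -> (o <= set_weight X)%R).

Definition is_OPT_WVC (I : wgraph) (o : rat) : Prop :=
  is_min_weight (fun X : {set I} => vertex_cover X) o.

(** No [o] qualifies when there is no modulator at all, which happens exactly
    when the graph with no vertices belongs to [F] (the optimum is then +oo). *)
Definition is_OPT_modulator (F : sgraph -> Prop) (I : wgraph) (o : rat) : Prop :=
  is_min_weight (fun M : {set I} => modulator F M) o.

(** Model of computation: structured programs with one variable ranging over
    binary trees, i.e. Neil Jones' WHILE language with its store packed into a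
    single tree.  The primitives build a cell, follow a pointer and test for
    [Leaf].  Trees are never modified in place, so they can be shared and every
    primitive takes constant time on a pointer machine; there is no unit-cost
    equality test or arithmetic.  Running time is the number of constructs
    executed, which makes polynomial time the same as on Turing machines (for
    outputs of polynomial size, as is the case for every encoding below). *)

Inductive tree : Type := Leaf | Node of tree & tree.

Fixpoint tree_size (x : tree) : nat :=
  if x is Node l r then (tree_size l + tree_size r).+1 else 1.

Definition lchild (x : tree) : tree := if x is Node l _ then l else Leaf.
Definition rchild (x : tree) : tree := if x is Node _ r then r else Leaf.

Inductive prog : Type :=
| PId
| PLeaf
| PLeft
| PRight
| PNode of prog & prog
| PSeq of prog & prog
| PIf of prog & prog & prog
| PWhile of prog & prog.

(** [runs p x y t]: on input [x], program [p] halts with output [y] after [t]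
    steps.  [Leaf] is false, every other tree is true. *)
Inductive runs : prog -> tree -> tree -> nat -> Prop :=
| RunId x : runs PId x x 1
| RunLeaf x : runs PLeaf x Leaf 1
| RunLeft x : runs PLeft x (lchild x) 1
| RunRight x : runs PRight x (rchild x) 1
| RunNode p q x y z t u :
    runs p x y t -> runs q x z u -> runs (PNode p q) x (Node y z) (t + u).+1
| RunSeq p q x y z t u :
    runs p x y t -> runs q y z u -> runs (PSeq p q) x z (t + u).+1
| RunIfTrue b p q x l r y t u :
    runs b x (Node l r) t -> runs p x y u -> runs (PIf b p q) x y (t + u).+1
| RunIfFalse b p q x y t u :
    runs b x Leaf t -> runs q x y u -> runs (PIf b p q) x y (t + u).+1
| RunWhileStop b p x t :
    runs b x Leaf t -> runs (PWhile b p) x x t.+1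
| RunWhileStep b p x l r y z t u v :
    runs b x (Node l r) t -> runs p x y u -> runs (PWhile b p) y z v ->
    runs (PWhile b p) x z (t + u + v).+1.

Lemma runs_det p x y t y' t' :
  runs p x y t -> runs p x y' t' -> y = y' /\ t = t'.
Proof.
move=> r; elim: r y' t' => {p x y t};
  intros; match goal with H : runs _ _ ?y' _ |- _ = ?y' /\ _ =>
    inversion H; subst; clear H
  end;
  repeat match goal with
  | IH : forall y t, runs ?p ?x y t -> _ /\ _, H : runs ?p ?x _ _ |- _ =>
      destruct (IH _ _ H); clear H; subst; try discriminate
  end; by [].
Qed.

(** A search problem has instances in [T] satisfying [promise]; [answer i y]
    says that the tree [y] encodes an admissible answer to [i].  Nothing is
    required of the program, not even termination, off the promise. *)
Definition poly_time_solvable (T : Type) (enc : T -> tree)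
    (promise : T -> Prop) (answer : T -> tree -> Prop) : Prop :=
  exists (p : prog) (c k : nat), forall i, promise i ->
    exists (y : tree) (t : nat),
      [/\ runs p (enc i) y t, t <= c * tree_size (enc i) ^ k + c & answer i y].

Definition enc_bool (b : bool) : tree := if b then Node Leaf Leaf else Leaf.

Definition enc_seq (T : Type) (enc : T -> tree) (s : seq T) : tree :=
  foldr (fun x r => Node (enc x) r) Leaf s.

Definition enc_option (T : Type) (enc : T -> tree) (o : option T) : tree :=
  if o is Some x then Node Leaf (enc x) else Leaf.

(** Binary digits, least significant first, without leading zeros. *)
Definition bits (n : nat) : seq bool :=
  mkseq (fun i => odd (n %/ 2 ^ i)) (up_log 2 n.+1).

Definition enc_nat (n : nat) : tree := enc_seq enc_bool (bits n).

(** Nonnegative rationals only: the sign of the numerator is dropped. *)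
Definition enc_rat (q : rat) : tree :=
  Node (enc_nat `|numq q|) (enc_nat `|denq q|).

(** Adjacency matrix in the order of [enum G]. *)
Definition enc_graph (G : sgraph) : tree :=
  enc_seq (fun x => enc_seq (fun y => enc_bool (edge x y)) (enum G)) (enum G).

Definition enc_set (G : sgraph) (S : {set G}) : tree :=
  enc_seq (fun x => enc_bool (x \in S)) (enum G).

Definition enc_wgraph (I : wgraph) : tree :=
  Node (enc_graph I) (enc_seq (fun x => enc_rat (weight x)) (enum I)).

(** [None] is the verdict "F-free". *)
Definition recognition_answer (F : sgraph -> Prop) (G : sgraph) (y : tree) : Prop :=
  exists2 o : option {set G}, y = enc_option (@enc_set G) o &
    if o is Some X then in_class F (induced X) else is_free F G.

Definition poly_time_recognition (F : sgraph -> Prop) : Prop :=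
  poly_time_solvable enc_graph (fun=> True) (recognition_answer F).

Definition poly_time_exact_WVC (F : sgraph -> Prop) : Prop :=
  poly_time_solvable enc_wgraph (fun I => is_free F I)
    (fun I y => exists X : {set I},
       [/\ y = enc_set X, vertex_cover X & is_OPT_WVC I (set_weight X)]).

(* Main.v *)
(** The algorithm is a local-ratio one.  While the subgraph induced by the vertices
    of positive weight contains a set T inducing a graph of F, subtract the least
    weight d in T from every vertex of T.  At most alpha vertices of T avoid a given
    vertex cover C, and every modulator M meets T, so |T| <= |T & C| + alpha |T & M|:
    a solution pays at most d |T| for this round, and w(C) + alpha w(M) drops by at
    least as much.  Each round makes a weight vanish, so after |V| rounds the positive
    part is F-free; the output is an optimal vertex cover of it together with all
    vertices of weight zero.

    Polynomial time is established for functions between encoded types, a class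
    closed under composition, branching and recursion on lists with polynomially
    bounded intermediate results. *)
Require Import Defs.
From mathcomp Require Import all_boot all_order all_algebra zify.
From Stdlib Require Import ClassicalEpsilon.
Import Order.TTheory GRing.Theory Num.Theory.
Set Implicit Arguments.
Unset Strict Implicit.
Unset Printing Implicit Defensive.

(** * Polynomial-time functions between encoded types *)

(** Iterating a polynomial-time step need not stay polynomial, so every loop carries a size bound on
    its intermediate values. For the rounds this bound comes from integrality: the weights are
    scaled once by the product of their denominators and can only decrease afterwards. A round that
    finds nothing changes nothing, so the number of rounds can be fixed beforehand and the main loop
    is a recursion on the rows of the adjacency matrix. The programs know no vertices. A vertex set
    is a list of bits along [enum G], an induced subgraph is a masking of rows and columns, and
    [expand] carries sets of the subgraph back. The two given algorithms are only relations between
    instances and output trees; choice turns them into functions, the second one on the subtype of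
    F-free instances, so that they compose with the other steps. The inequality is proved in integer
    weights against an arbitrary vertex cover and an arbitrary modulator; the rational optima enter
    only at the very end. *)

Inductive polygrowth : (nat -> nat) -> Prop :=
| polygrowth_const c : polygrowth (fun=> c)
| polygrowth_id : polygrowth (fun n => n)
| polygrowth_add f g :
    polygrowth f -> polygrowth g -> polygrowth (fun n => f n + g n)
| polygrowth_mul f g :
    polygrowth f -> polygrowth g -> polygrowth (fun n => f n * g n).

Lemma polygrowth_comp f g :
  polygrowth f -> polygrowth g -> polygrowth (fun n => f (g n)).
Proof.
by move=> pf pg; elim: pf => *; [exact: polygrowth_const | | exact: polygrowth_add
  | exact: polygrowth_mul].
Qed.

Ltac solve_polygrowth :=
  repeat first
    [ assumption | exact (polygrowth_const _) | exact polygrowth_id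
    | apply: polygrowth_add | apply: polygrowth_mul
    | match goal with |- polygrowth (fun n => ?f (@?g n)) =>
        is_var f; apply: (@polygrowth_comp f g) end ].

Lemma polygrowth_mono f : polygrowth f -> {homo f : m n / m <= n}.
Proof.
elim=> [c||{}f g _ mf _ mg|{}f g _ mf _ mg] m n le_mn //.
  by rewrite leq_add ?mf ?mg.
by rewrite leq_mul ?mf ?mg.
Qed.

Lemma polygrowth_exp k : exists2 f, polygrowth f & forall n, n ^ k = f n.
Proof.
elim: k => [|k [f pf fE]]; first by exists (fun=> 1) => //; exact: polygrowth_const.
exists (fun n => n * f n) => [|n]; last by rewrite expnS fE.
by apply: polygrowth_mul => //; exact: polygrowth_id.
Qed.

(** Leads back to the form [c * n ^ k + c] of [poly_time_solvable], which is awkward to compose;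
    [polygrowth] is closed under composition and consists of monotone functions. *)
Lemma polygrowth_leq_exp f :
  polygrowth f -> exists c k, forall n, f n <= c * n ^ k + c.
Proof.
(* The summand 1 is for [n = 0] and [k = 0], where the left side is 1 and the power on the right may
   be 0. *)
have pow n k d : n ^ k <= n ^ (k + d) + 1.
  case: n => [|n]; first by case: k => [|k]; rewrite ?leq_addl // exp0n.
  by apply: leq_trans (leq_addr 1 _); rewrite leq_pexp2l ?leq_addr.
elim=> [c|| {}f g _ [c [k fP]] _ [d [l gP]]| {}f g _ [c [k fP]] _ [d [l gP]]].
- by exists c, 0 => n; rewrite leq_addl.
- by exists 1, 1 => n; rewrite mul1n expn1 leq_addr.
- exists (2 * (c + d)), (k + l) => n; have := fP n; have := gP n.
  have := pow n k l; have := pow n l k; rewrite (addnC l); nia.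
- exists (4 * c * d), (k + l) => n; have := leq_mul (fP n) (gP n).
  have := pow n k l; have := pow n l k; rewrite (addnC l) expnD; nia.
Qed.

(** The output size is bounded along with the running time: trees are shared, so
    an output can be exponentially larger than the time spent building it. *)
Variant polytime A B (ea : A -> tree) (eb : B -> tree) (f : A -> B) : Prop :=
  Polytime (p : prog) (b : nat -> nat) of polygrowth b &
    (forall a, exists2 t, runs p (ea a) (eb (f a)) t &
      t + tree_size (eb (f a)) <= b (tree_size (ea a))).

(** The same program serves, because only the trees matter. This is how a number is read as its list
    of digits, or an instance as an element of a subtype. *)
Lemma polytime_eq A B A' B' (ea : A -> tree) (eb : B -> tree) (ea' : A' -> tree)
    (eb' : B' -> tree) (f : A -> B) (f' : A' -> B') (h : A' -> A) :
  polytime ea eb f -> (forall x, ea' x = ea (h x)) ->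
  (forall x, eb' (f' x) = eb (f (h x))) -> polytime ea' eb' f'.
Proof.
move=> [p b pb H] eqa eqb; apply: (@Polytime _ _ _ _ _ p b) => // x.
by rewrite eqa eqb; exact: H.
Qed.

Lemma polytime_ext A B (ea : A -> tree) (eb : B -> tree) (f g : A -> B) :
  f =1 g -> polytime ea eb f -> polytime ea eb g.
Proof. by move=> fg H; apply: (polytime_eq (h := id) H) => // x; rewrite -fg. Qed.

Lemma polytime_comp A B C (ea : A -> tree) (eb : B -> tree) (ec : C -> tree)
    (g : B -> C) (f : A -> B) :
  polytime eb ec g -> polytime ea eb f -> polytime ea ec (fun a => g (f a)).
Proof.
move=> [q d pd Hq] [p b pb Hp].
apply: (@Polytime _ _ _ _ _ (PSeq p q) (fun n => b n + d (b n) + 1)).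
  by solve_polygrowth.
move=> a; have [t rt lt_] := Hp a; have [u ru lu] := Hq (f a).
exists (t + u).+1; first exact: RunSeq rt ru.
have : tree_size (eb (f a)) <= b (tree_size (ea a)) by lia.
move/(polygrowth_mono pd); lia.
Qed.

Lemma polytime_recode A B (ea : A -> tree) (eb : B -> tree) (f : A -> B) :
  (forall a, eb (f a) = ea a) -> polytime ea eb f.
Proof.
move=> eq_enc; apply: (@Polytime _ _ _ _ _ PId (fun n => n + 1)).
  by solve_polygrowth.
by move=> a; rewrite eq_enc; exists 1; [constructor | rewrite addnC].
Qed.

Lemma polytime_id A (ea : A -> tree) : polytime ea ea id.
Proof. exact: polytime_recode. Qed.

Lemma polytime_left A B (ea : A -> tree) (eb : B -> tree) (f : A -> B) :
  (forall a, eb (f a) = lchild (ea a)) -> polytime ea eb f.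
Proof.
move=> eq_enc; apply: (@Polytime _ _ _ _ _ PLeft (fun n => n + 1)).
  by solve_polygrowth.
move=> a; rewrite eq_enc; exists 1; first by constructor.
by rewrite addnC leq_add2r; case: (ea a) => //= l r; rewrite leqW ?leq_addr.
Qed.

Lemma polytime_right A B (ea : A -> tree) (eb : B -> tree) (f : A -> B) :
  (forall a, eb (f a) = rchild (ea a)) -> polytime ea eb f.
Proof.
move=> eq_enc; apply: (@Polytime _ _ _ _ _ PRight (fun n => n + 1)).
  by solve_polygrowth.
move=> a; rewrite eq_enc; exists 1; first by constructor.
by rewrite addnC leq_add2r; case: (ea a) => //= l r; rewrite leqW ?leq_addl.
Qed.

Lemma polytime_node A B C D (ea : A -> tree) (eb : B -> tree) (ec : C -> tree)
    (ed : D -> tree) (f : A -> B) (g : A -> C) (h : A -> D) :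
  polytime ea eb f -> polytime ea ec g ->
  (forall a, ed (h a) = Node (eb (f a)) (ec (g a))) -> polytime ea ed h.
Proof.
move=> [p b pb Hp] [q d pd Hq] eq_enc.
apply: (@Polytime _ _ _ _ _ (PNode p q) (fun n => b n + d n + 2)).
  by solve_polygrowth.
move=> a; have [t rt lt_] := Hp a; have [u ru lu] := Hq a; rewrite eq_enc.
exists (t + u).+1; first exact: RunNode.
rewrite /=; lia.
Qed.

Fixpoint const_prog (x : tree) : prog :=
  if x is Node l r then PNode (const_prog l) (const_prog r) else PLeaf.

Lemma polytime_const A B (ea : A -> tree) (eb : B -> tree) (y : B) :
  polytime ea eb (fun=> y).
Proof.
pose t := fix t x := if x is Node l r then (t l + t r).+1 else 1.
apply: (@Polytime _ _ _ _ _ (const_prog (eb y)) (fun=> t (eb y) + tree_size (eb y))) => [|a].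
  exact: polygrowth_const.
exists (t (eb y)) => //.
by elim: (eb y) => [|l IHl r IHr] /=; constructor.
Qed.

(** The test looks at the tree of [f a], so booleans and lists alike can serve as conditions. *)
Lemma polytime_branch A B C (ea : A -> tree) (eb : B -> tree) (ec : C -> tree)
    (f : A -> B) (g1 g2 g : A -> C) :
  polytime ea eb f -> polytime ea ec g1 -> polytime ea ec g2 ->
  (forall a, ec (g a) = if eb (f a) is Leaf then ec (g2 a) else ec (g1 a)) ->
  polytime ea ec g.
Proof.
move=> [p b pb Hp] [q d pd Hq] [r e pe Hr] eq_enc.
apply: (@Polytime _ _ _ _ _ (PIf p q r) (fun n => b n + d n + e n + 1)).
  by solve_polygrowth.
move=> a; have [t rt lt_] := Hp a; have [u ru lu] := Hq a.
have [v rv lv] := Hr a; rewrite eq_enc.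
case E: (eb (f a)) rt => [|x y] rt.
  by exists (t + v).+1; [exact: RunIfFalse rt rv | lia].
by exists (t + u).+1; [exact: RunIfTrue rt ru | lia].
Qed.

Definition enc_pair A B (ea : A -> tree) (eb : B -> tree) (p : A * B) : tree :=
  Node (ea p.1) (eb p.2).

Definition enc_unit (x : unit) : tree := Leaf.

Section Closure.
Context {A : Type} {ea : A -> tree}.

Lemma polytime_fst B C (eb : B -> tree) (ec : C -> tree) (f : A -> B * C) :
  polytime ea (enc_pair eb ec) f -> polytime ea eb (fun a => (f a).1).
Proof. by move/(polytime_comp (g := fst)); apply; exact: polytime_left. Qed.

Lemma polytime_snd B C (eb : B -> tree) (ec : C -> tree) (f : A -> B * C) :
  polytime ea (enc_pair eb ec) f -> polytime ea ec (fun a => (f a).2).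
Proof. by move/(polytime_comp (g := snd)); apply; exact: polytime_right. Qed.

Lemma polytime_pair B C (eb : B -> tree) (ec : C -> tree) (f : A -> B)
    (g : A -> C) :
  polytime ea eb f -> polytime ea ec g ->
  polytime ea (enc_pair eb ec) (fun a => (f a, g a)).
Proof. by move=> pf pg; exact: polytime_node pf pg _. Qed.

Lemma polytime_if B (eb : B -> tree) (c : A -> bool) (f g : A -> B) :
  polytime ea enc_bool c -> polytime ea eb f -> polytime ea eb g ->
  polytime ea eb (fun a => if c a then f a else g a).
Proof. by move=> pc pf pg; apply: (polytime_branch pc pf pg) => a; case: (c a). Qed.

Lemma polytime_and (b c : A -> bool) :
  polytime ea enc_bool b -> polytime ea enc_bool c ->
  polytime ea enc_bool (fun a => b a && c a).
Proof. by move=> pb pc; apply: polytime_if => //; exact: polytime_const. Qed.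

Lemma polytime_or (b c : A -> bool) :
  polytime ea enc_bool b -> polytime ea enc_bool c ->
  polytime ea enc_bool (fun a => b a || c a).
Proof. by move=> pb pc; apply: polytime_if => //; exact: polytime_const. Qed.

Lemma polytime_neg (b : A -> bool) :
  polytime ea enc_bool b -> polytime ea enc_bool (fun a => ~~ b a).
Proof. by move=> pb; apply: polytime_if => //; exact: polytime_const. Qed.

Lemma polytime_addb (b c : A -> bool) :
  polytime ea enc_bool b -> polytime ea enc_bool c ->
  polytime ea enc_bool (fun a => b a (+) c a).
Proof.
move=> pb pc; apply: (polytime_ext _ (polytime_if pb (polytime_neg pc) pc)) => a.
by case: (b a).
Qed.

Lemma polytime_some B (eb : B -> tree) (f : A -> B) :
  polytime ea eb f -> polytime ea (enc_option eb) (fun a => Some (f a)).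
Proof.
move=> pf; apply: (polytime_node (ec := eb) (eb := enc_unit) _ pf) => //.
exact: polytime_const tt.
Qed.

(** Not an instance of [polytime_branch]: on [None] there is no element of [B] to pass to [f], and
    its program is under control on encodings only. Hence the program is built by hand, with the
    pair prepared as a raw tree and [p] run in the [Some] branch alone. *)
Lemma polytime_omatch B C (eb : B -> tree) (ec : C -> tree) (o : A -> option B)
    (f : A -> B -> C) (g : A -> C) :
  polytime ea (enc_option eb) o ->
  polytime (enc_pair ea eb) ec (fun p => f p.1 p.2) -> polytime ea ec g ->
  polytime ea ec (fun a => if o a is Some x then f a x else g a).
Proof.
move=> po pf pg.
have pr : polytime ea id (fun a => rchild (enc_option eb (o a))).
  apply: (polytime_comp (g := fun o => rchild (enc_option eb o)) _ po).
    exact: polytime_right.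
have [q d pd Hq] :
    polytime ea id (fun a => Node (ea a) (rchild (enc_option eb (o a)))).
  exact: polytime_node (polytime_id ea) pr _.
have [p b pb Hp] := pf; have [r e pe Hr] := po.
have [s k pk Hs] := pg.
apply: (@Polytime _ _ _ _ _ (PIf r (PSeq q p) s) (fun n => d n + b (d n) + e n + k n + 2)).
  by solve_polygrowth.
move=> a; have [t rt lt_] := Hr a; have [u ru lu] := Hs a.
have [v rv lv] := Hq a; move: rt rv lt_ lv.
case: (o a) => [x|] /= rt rv lt_ lv; last first.
  by exists (t + u).+1; [exact: RunIfFalse rt ru | lia].
have [w rw lw] := Hp (a, x); exists (t + (v + w).+1).+1.
  by apply: RunIfTrue rt _; apply: RunSeq rv rw.
have : tree_size (enc_pair ea eb (a, x)) <= d (tree_size (ea a)) by move: lv => /=; lia.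
by move/(polygrowth_mono pb) => /= ?; move: lw => /=; lia.
Qed.

Lemma polytime_cons B (eb : B -> tree) (f : A -> B) (g : A -> seq B) :
  polytime ea eb f -> polytime ea (enc_seq eb) g ->
  polytime ea (enc_seq eb) (fun a => f a :: g a).
Proof. by move=> pf pg; exact: polytime_node pf pg _. Qed.

Lemma polytime_behead B (eb : B -> tree) (f : A -> seq B) :
  polytime ea (enc_seq eb) f -> polytime ea (enc_seq eb) (fun a => behead (f a)).
Proof. by move/(polytime_comp (g := behead)); apply; apply: polytime_right; case. Qed.

Lemma polytime_nilp B (eb : B -> tree) (f : A -> seq B) :
  polytime ea (enc_seq eb) f -> polytime ea enc_bool (fun a => nilp (f a)).
Proof.
move=> pf; apply: (polytime_branch pf (polytime_const _ _ false)
  (polytime_const _ _ true)).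
by move=> a; case: (f a).
Qed.

Lemma polytime_head B (eb : B -> tree) (d : B) (f : A -> seq B) :
  polytime ea (enc_seq eb) f -> polytime ea eb (fun a => head d (f a)).
Proof.
move=> pf; have pl : polytime ea id (fun a => lchild (enc_seq eb (f a))).
  apply: (polytime_comp (g := fun l => lchild (enc_seq eb l)) _ pf).
    exact: polytime_left.
have pc : polytime ea id (fun a : A => eb d).
  exact: (polytime_eq (h := id) (polytime_const ea eb d)).
have pm : polytime ea id (fun a => if f a is x :: _ then eb x else eb d).
  by apply: polytime_branch pf pl pc _ => a; case: (f a).
by apply: (polytime_eq (h := id) pm) => // a; case: (f a).
Qed.

End Closure.

(** * Bounded recursion on lists *)

Lemma tree_size_seq B (eb : B -> tree) (l : seq B) :
  tree_size (enc_seq eb l) = (\sum_(x <- l) (tree_size (eb x)).+1).+1.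
Proof. by elim: l => [|x l IH] /=; rewrite ?big_nil // big_cons IH addnS. Qed.

Lemma size_enc_seq B (eb : B -> tree) (l : seq B) :
  size l < tree_size (enc_seq eb l).
Proof. by elim: l => //= x l IH; rewrite ltnS; lia. Qed.

(** The loop consumes the list from its head while the accumulator holds the value on the prefix
    already read; this is why the recursion equation is stated for [rcons]. The bound [b] on all
    values keeps the iterated step polynomial. *)
Lemma polytime_rec A B E (ea : A -> tree) (eb : B -> tree) (ee : E -> tree)
    (g : E -> seq B -> A) (step : E * B * A -> A) (b : nat -> nat) :
  polytime ee ea (fun e => g e [::]) ->
  polytime (enc_pair (enc_pair ee eb) ea) ea step ->
  (forall e l x, g e (rcons l x) = step (e, x, g e l)) ->
  polygrowth b ->
  (forall e l, tree_size (ea (g e l)) <=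
     b (tree_size (ee e) + tree_size (enc_seq eb l))) ->
  polytime (enc_pair ee (enc_seq eb)) ea (fun p => g p.1 p.2).
Proof.
move=> [p d pd Hp] [q k pk Hq] gS pb gB.
(* The store holds the unread list, the environment and the accumulator ([st] below), so [PLeft] is
   the loop guard. [body] drops the first item, keeps the environment and feeds [q] with the triple.
   In [T], 22 is the cost of one turn apart from [q], and the argument of [k] bounds the size of
   that triple. *)
pose body := PNode (PSeq PLeft PRight) (PNode (PSeq PRight PLeft) (PSeq (PNode
  (PNode (PSeq PRight PLeft) (PSeq PLeft PLeft)) (PSeq PRight PRight)) q)).
pose T n := 22 + k (n + b n + 2).
apply: (@Polytime _ _ _ _ _
  (PSeq (PNode PRight (PNode PLeft (PSeq PLeft p)))
    (PSeq (PWhile PLeft body) (PSeq PRight PRight)))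
  (fun n => d n + n * T n + b n + 20)).
  by rewrite ?/T; solve_polygrowth.
move=> [e l] /=; set n := _.+1.
pose st l2 x := Node (enc_seq eb l2) (Node (ee e) x).
have loop l1 l2 : l = l1 ++ l2 -> exists2 t,
    runs (PWhile PLeft body) (st l2 (ea (g e l1))) (st [::] (ea (g e l))) t &
    t <= size l2 * T n + 2.
  elim: l2 l1 => [|x l2 IH] l1 El.
    by rewrite El cats0; exists 2 => //; apply: RunWhileStop; constructor.
  have [|t rt lt_] := IH (rcons l1 x); first by rewrite El cat_rcons.
  have [u ru lu] := Hq (e, x, g e l1); rewrite -gS in ru lu.
  have leu : u <= k (n + b n + 2).
    apply: leq_trans (leq_trans (leq_addr _ _) lu) _; apply: (polygrowth_mono pk).
    have : tree_size (ea (g e l1)) <= b n.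
      apply: leq_trans (gB _ _) _; apply: (polygrowth_mono pb).
      rewrite /n El !tree_size_seq big_cat /=; lia.
    by rewrite /n El !tree_size_seq big_cat big_cons /=; lia.
  have rb : runs body (st (x :: l2) (ea (g e l1))) (st l2 (ea (g e (rcons l1 x))))
      (u + 20).
    have -> : u + 20 = ((1 + 1).+1 + ((1 + 1).+1 + ((((1 + 1).+1 + (1 + 1).+1).+1
      + (1 + 1).+1).+1 + u).+1).+1).+1 by lia.
    apply: RunNode; first exact: RunSeq (RunLeft _) (RunRight _).
    apply: RunNode; first exact: RunSeq (RunRight _) (RunLeft _).
    apply: RunSeq ru; apply: RunNode (RunSeq (RunRight _) (RunRight _)).
    exact: RunNode (RunSeq (RunRight _) (RunLeft _)) (RunSeq (RunLeft _) (RunLeft _)).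
  exists (1 + (u + 20) + t).+1; last first.
    by move: lt_; rewrite /= mulSn; set m := size l2 * T n; rewrite /T; lia.
  have rl : runs PLeft (st (x :: l2) (ea (g e l1))) (Node (eb x) (enc_seq eb l2)) 1.
    exact: RunLeft.
  exact: RunWhileStep rl rb rt.
have [t rt lt_] := loop [::] l erefl; have [u ru lu] := Hp e.
exists ((1 + (1 + (1 + u).+1).+1).+1 + (t + (1 + 1).+1).+1).+1.
  have r0 : runs (PNode PRight (PNode PLeft (PSeq PLeft p)))
      (Node (ee e) (enc_seq eb l)) (st l (ea (g e [::]))) (1 + (1 + (1 + u).+1).+1).+1.
    apply: RunNode; first exact: RunRight.
    by apply: RunNode; [exact: RunLeft | apply: RunSeq ru; exact: RunLeft].
  have r1 : runs (PSeq PRight PRight) (st [::] (ea (g e l))) (ea (g e l)) (1 + 1).+1.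
    exact: RunSeq (RunRight _) (RunRight _).
  exact: RunSeq r0 (RunSeq rt r1).
have dn : d (tree_size (ee e)) <= d n by rewrite (polygrowth_mono pd) // /n; lia.
have bn : tree_size (ea (g e l)) <= b n.
  by apply: leq_trans (gB _ _) _; apply: (polygrowth_mono pb); rewrite /n; lia.
have : size l * T n <= n * T n by rewrite leq_mul // /n; have := size_enc_seq eb l; lia.
rewrite /enc_pair /=; lia.
Qed.

Ltac polytime_extra := fail. (* redefined as more operations become available *)

Ltac solve_polytime :=
  cbv beta;
  solve [repeat lazymatch goal with |- polytime _ _ _ => first
    [ eassumption | refine (polytime_const _ _ _) | refine (polytime_id _)
    | lazymatch goal with
      | |- polytime _ _ (fun x => (@?f x).1) => refine (polytime_fst (f := f) _)
      | |- polytime _ _ (fun x => (@?f x).2) => refine (polytime_snd (f := f) _)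
      | |- polytime _ _ (fun x => (_, _)) => refine (polytime_pair _ _)
      | |- polytime _ _ (fun x => if _ then _ else _) => refine (polytime_if _ _ _)
      | |- polytime _ _ (fun x => Some _) => refine (polytime_some _)
      | |- polytime _ _ (fun x => _ :: _) => refine (polytime_cons _ _)
      | |- polytime _ _ (fun x => _ && _) => refine (polytime_and _ _)
      | |- polytime _ _ (fun x => _ || _) => refine (polytime_or _ _)
      | |- polytime _ _ (fun x => ~~ _) => refine (polytime_neg _)
      | |- polytime _ _ (fun x => _ (+) _) => refine (polytime_addb _ _)
      | |- polytime _ _ (fun x => behead _) => refine (polytime_behead _)
      | |- polytime _ _ (fun x => nilp _) => refine (polytime_nilp _)
      | |- polytime _ _ (fun x => head _ _) => refine (polytime_head _ _)
      | |- polytime _ _ fst => refine (polytime_fst (f := id) _)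
      | |- polytime _ _ snd => refine (polytime_snd (f := id) _)
      | |- _ => polytime_extra
      end ] end].

Lemma polytime_size A B (ea : A -> tree) (eb : B -> tree) (f : A -> B) :
  polytime ea eb f -> exists2 b, polygrowth b &
    forall a, tree_size (eb (f a)) <= b (tree_size (ea a)).
Proof.
move=> [p b pb H]; exists b => // a; have [t _] := H a.
exact/leq_trans/leq_addl.
Qed.

Lemma polytime_rec_at X A B E (ex : X -> tree) (ea : A -> tree) (eb : B -> tree)
    (ee : E -> tree) (g : E -> seq B -> A) (step : E * B * A -> A) (b : nat -> nat)
    (e : X -> E) (l : X -> seq B) :
  polytime ee ea (fun e => g e [::]) ->
  polytime (enc_pair (enc_pair ee eb) ea) ea step ->
  (forall e l x, g e (rcons l x) = step (e, x, g e l)) ->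
  polygrowth b ->
  (forall e l, tree_size (ea (g e l)) <=
     b (tree_size (ee e) + tree_size (enc_seq eb l))) ->
  polytime ex ee e -> polytime ex (enc_seq eb) l ->
  polytime ex ea (fun x => g (e x) (l x)).
Proof.
move=> p0 pstep gS pb gB pe pl.
exact: polytime_comp (polytime_rec p0 pstep gS pb gB) (polytime_pair pe pl).
Qed.

Lemma tree_size_rev B (eb : B -> tree) (l : seq B) :
  tree_size (enc_seq eb (rev l)) = tree_size (enc_seq eb l).
Proof.
elim: l => // x l; rewrite rev_cons -cats1 !tree_size_seq big_cat big_seq1 big_cons.
by case=> ->; rewrite addnC.
Qed.

Lemma polytime_rev X B (ex : X -> tree) (eb : B -> tree) (l : X -> seq B) :
  polytime ex (enc_seq eb) l -> polytime ex (enc_seq eb) (fun x => rev (l x)).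
Proof.
move=> pl; apply: (polytime_rec_at (g := fun=> rev) (e := fun=> tt) (ee := enc_unit)
  (step := fun p => p.1.2 :: p.2) (b := fun n => n) _ _ _ _ _ _ pl).
- solve_polytime.
- solve_polytime.
- by move=> ? l' x; rewrite rev_rcons.
- solve_polygrowth.
- by move=> e l'; rewrite tree_size_rev leq_addl.
- solve_polytime.
Qed.

(** * List transducers *)

Section Transducer.
Variables (S B C : Type) (f : S -> B -> S * option C).

Definition final_state : S -> seq B -> S := foldl (fun s x => (f s x).1).

(** A Mealy machine that may also emit nothing. [map], [mask], [expand], [zip] and binary
    subtraction are instances: the state is a fixed environment, the rest of another list, or the
    rest of the subtrahend with the borrow. *)
Fixpoint transduce (s : S) (l : seq B) : seq C :=
  if l is x :: l' then
    if (f s x).2 is Some y then y :: transduce (f s x).1 l'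
    else transduce (f s x).1 l'
  else [::].

(** The output is kept reversed, because the recursion produces it at the far end while only consing
    is cheap. *)
Lemma transduce_rcons s l x :
  rev (transduce s (rcons l x)) =
  if (f (final_state s l) x).2 is Some y then y :: rev (transduce s l)
  else rev (transduce s l).
Proof.
elim: l s => [|z l IH] s /=; first by case: (f s x).2.
case: (f s z).2 => [y|]; rewrite ?IH //= !rev_cons IH /final_state /=.
by case: (f _ x).2.
Qed.

Lemma final_state_rcons s l x :
  final_state s (rcons l x) = (f (final_state s l) x).1.
Proof. exact: foldl_rcons. Qed.

Variables (es : S -> tree) (eb : B -> tree) (ec : C -> tree) (b : nat -> nat).
Hypothesis pf : polytime (enc_pair es eb) (enc_pair es (enc_option ec))
  (fun p => f p.1 p.2).
Hypothesis pb : polygrowth b.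
Hypothesis state_bound : forall s l, tree_size (es (final_state s l)) <=
  b (tree_size (es s) + tree_size (enc_seq eb l)).

(** Bounding the states is enough: each letter emitted has size polynomial in a state and an input
    letter, and there is at most one per input letter. The final state is returned as well, since
    subtraction reads off it whether the result is negative. *)
Lemma polytime_transduce_state X (ex : X -> tree) (s : X -> S) (l : X -> seq B) :
  polytime ex es s -> polytime ex (enc_seq eb) l ->
  polytime ex (enc_pair es (enc_seq ec))
    (fun x => (final_state (s x) (l x), transduce (s x) (l x))).
Proof.
move=> ps pl.
have [k pk kP] := polytime_size pf.
suff pg : polytime ex (enc_pair es (enc_seq ec))
    (fun x => (final_state (s x) (l x), rev (transduce (s x) (l x)))).
  apply: polytime_ext (polytime_pair (polytime_fst pg) (polytime_rev (polytime_snd pg))).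
  by move=> x; rewrite /= revK.
apply: (polytime_rec_at (g := fun s l => (final_state s l, rev (transduce s l)))
  (step := fun p => ((f p.2.1 p.1.2).1,
     if (f p.2.1 p.1.2).2 is Some y then y :: p.2.2 else p.2.2))
  (b := fun n => b n + n * (k (b n + n + 1) + 1) + 2) _ _ _ _ _ ps pl).
- by apply: polytime_pair; solve_polytime.
- have pf' : polytime (enc_pair (enc_pair es eb) (enc_pair es (enc_seq ec)))
     (enc_pair es (enc_option ec)) (fun p => f p.2.1 p.1.2).
    apply: (polytime_comp pf (f := fun p => (p.2.1, p.1.2))); solve_polytime.
  apply: polytime_pair; first solve_polytime.
  apply: (polytime_omatch (f := fun p y => y :: p.2.2)); last solve_polytime.
    solve_polytime.
  solve_polytime.
- by move=> e l' x; rewrite final_state_rcons transduce_rcons.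
- solve_polygrowth.
move=> e l'; set n := tree_size (es e) + _ => /=.
(* Generalised to prefixes with [n] kept fixed, so that the single bound [k (b n + n + 1)] applies
   to every letter. *)
suff /(_ l') : forall l0, tree_size (es e) + tree_size (enc_seq eb l0) <= n ->
    tree_size (enc_seq ec (rev (transduce e l0))) <= size l0 * (k (b n + n + 1) + 1) + 1.
  move/(_ (leqnn _)); have := state_bound e l'; rewrite -/n.
  have : size l' * (k (b n + n + 1) + 1) <= n * (k (b n + n + 1) + 1).
    by rewrite leq_mul2r /n; have := size_enc_seq eb l'; lia.
  by move=> *; lia.
elim/last_ind => [|l0 x IH] //.
rewrite tree_size_seq -cats1 big_cat big_seq1 /= => le_n.
have /IH {}IH : tree_size (es e) + tree_size (enc_seq eb l0) <= n.
  by rewrite tree_size_seq; lia.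
rewrite cats1 transduce_rcons size_rcons mulSn.
have := kP (final_state e l0, x); have := state_bound e l0.
have : b (tree_size (es e) + tree_size (enc_seq eb l0)) <= b n.
  by apply: (polygrowth_mono pb); rewrite tree_size_seq; lia.
move=> le1 le2.
have : k (tree_size (enc_pair es eb (final_state e l0, x))) <= k (b n + n + 1).
  by apply: (polygrowth_mono pk); rewrite /=; lia.
rewrite {3}/enc_pair /=; case: (f _ x).2 => [y|] /=; lia.
Qed.

Lemma polytime_transduce X (ex : X -> tree) (s : X -> S) (l : X -> seq B) :
  polytime ex es s -> polytime ex (enc_seq eb) l ->
  polytime ex (enc_seq ec) (fun x => transduce (s x) (l x)).
Proof. by move=> ps pl; exact: polytime_snd (polytime_transduce_state ps pl). Qed.

End Transducer.

Lemma polytime_map X E B C (ex : X -> tree) (ee : E -> tree) (eb : B -> tree)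
    (ec : C -> tree) (f : E -> B -> C) (e : X -> E) (l : X -> seq B) :
  polytime (enc_pair ee eb) ec (fun p => f p.1 p.2) ->
  polytime ex ee e -> polytime ex (enc_seq eb) l ->
  polytime ex (enc_seq ec) (fun x => [seq f (e x) y | y <- l x]).
Proof.
move=> pf pe pl; pose h (s : E) y := (s, Some (f s y)).
have fin s l' : final_state h s l' = s by elim: l'.
apply: polytime_ext (polytime_transduce (f := h) (b := fun n => n) _ _ _ pe pl).
- by move=> x; elim: (l x) => //= y l' ->.
- by rewrite /h; solve_polytime.
- solve_polygrowth.
- by move=> s l'; rewrite fin leq_addr.
Qed.

Lemma tree_size_behead B (eb : B -> tree) (l : seq B) :
  tree_size (enc_seq eb (behead l)) <= tree_size (enc_seq eb l).
Proof. by case: l => //= x l; rewrite leqW ?leq_addl. Qed.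

Lemma polytime_mask X B (ex : X -> tree) (eb : B -> tree) (m : X -> seq bool)
    (l : X -> seq B) :
  polytime ex (enc_seq enc_bool) m -> polytime ex (enc_seq eb) l ->
  polytime ex (enc_seq eb) (fun x => mask (m x) (l x)).
Proof.
move=> pm pl; pose h (s : seq bool) (y : B) :=
  (behead s, if head false s then Some y else None).
apply: polytime_ext (polytime_transduce (f := h) (b := fun n => n) _ _ _ pm pl).
- move=> x; elim: (l x) (m x) => [|y l' IH] [|c m'] //=; rewrite IH; case: c => //.
- by rewrite /h; solve_polytime.
- solve_polygrowth.
- move=> s l'; elim: l' s => [|y l' IH] s; first exact: leq_addr.
  apply: leq_trans (IH (behead s)) _; rewrite leq_add ?tree_size_behead //.
  exact: tree_size_behead (y :: l').
Qed.

(** Undoes [mask m]: the bits of [r] go to the true positions of [m], and [d] to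
    the others. *)
Fixpoint expand (d : bool) (m r : seq bool) : seq bool :=
  if m is x :: m' then
    if x then head d r :: expand d m' (behead r) else d :: expand d m' r
  else [::].

Lemma polytime_expand X (ex : X -> tree) (d : bool) (m r : X -> seq bool) :
  polytime ex (enc_seq enc_bool) m -> polytime ex (enc_seq enc_bool) r ->
  polytime ex (enc_seq enc_bool) (fun x => expand d (m x) (r x)).
Proof.
move=> pm pr; pose h (s : seq bool) (y : bool) :=
  (if y then behead s else s, Some (if y then head d s else d)).
apply: polytime_ext (polytime_transduce (f := h) (b := fun n => n) _ _ _ pr pm).
- by move=> x; elim: (m x) (r x) => [|[] m' IH] r' //=; rewrite IH.
- by rewrite /h; solve_polytime.
- solve_polygrowth.
- move=> s l'; elim: l' s => [|y l' IH] s; first exact: leq_addr.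
  apply: leq_trans (IH _) _; rewrite leq_add //.
    by case: y => /=; rewrite ?tree_size_behead.
  exact: tree_size_behead (y :: l').
Qed.

Lemma polytime_zip X B C (ex : X -> tree) (eb : B -> tree) (ec : C -> tree)
    (d : C) (l : X -> seq B) (s : X -> seq C) :
  polytime ex (enc_seq eb) l -> polytime ex (enc_seq ec) s ->
  polytime ex (enc_seq (enc_pair eb ec)) (fun x => zip (l x) (s x)).
Proof.
move=> pl ps; pose h (s : seq C) (y : B) :=
  (behead s, if nilp s then None else Some (y, head d s)).
apply: polytime_ext (polytime_transduce (f := h) (b := fun n => n) _ _ _ ps pl).
- move=> x; elim: (l x) (s x) => [|y l' IH] [|z s'] //=; last by rewrite IH.
  by rewrite IH; case: l' {IH}.
- by rewrite /h; solve_polytime.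
- by solve_polygrowth.
- move=> s' l'; elim: l' s' => [|y l' IH] s'; first exact: leq_addr.
  apply: leq_trans (IH (behead s')) _; rewrite leq_add ?tree_size_behead //.
  exact: tree_size_behead (y :: l').
Qed.

(** * Binary arithmetic *)

Lemma bitsS n : 0 < n -> bits n = odd n :: bits n./2.
Proof.
move=> n0; rewrite /bits.
have -> : up_log 2 n.+1 = (up_log 2 (n./2).+1).+1.
  apply: up_log_eq => //; have := up_logP (n./2).+1 (isT : 1 < 2).
  set k := up_log _ _ => le1.
  have le2 : 2 ^ k <= n.
    rewrite /k; case: (posnP n./2) => [-> //|h0].
    have /andP[] := @up_log_bounds 2 (n./2).+1 isT h0.
    by case: (up_log _ _) => [|j] /=; rewrite ?expnS; lia.
  by rewrite expnS; apply/andP; split; lia.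
rewrite /mkseq /= expn0 divn1; congr (_ :: _).
rewrite -[1]/(1 + 0) iotaDl -map_comp; apply: eq_map => i /=.
by rewrite expnS divnMA divn2.
Qed.

(** Horner evaluation from the most significant digit suits [polytime_rec], as appending a digit is
    one doubling. [bits] has the opposite order, hence the reversals. *)
Definition msb_val (l : seq bool) : nat := foldl (fun n (b : bool) => b + n.*2) 0 l.

Fixpoint lsb_val (l : seq bool) : nat :=
  if l is b :: l' then b + (lsb_val l').*2 else 0.

Lemma msb_val_rcons l (b : bool) : msb_val (rcons l b) = b + (msb_val l).*2.
Proof. exact: foldl_rcons. Qed.

Lemma msb_val_rev l : msb_val (rev l) = lsb_val l.
Proof. by elim: l => //= b l IH; rewrite rev_cons msb_val_rcons IH. Qed.

Lemma lsb_val_lt l : lsb_val l < 2 ^ size l.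
Proof. by elim: l => //= b l; rewrite expnS; case: b; lia. Qed.

Lemma msb_val_lt l : msb_val l < 2 ^ size l.
Proof. by rewrite -[l]revK msb_val_rev size_rev lsb_val_lt. Qed.

Lemma lsb_val_bits n : lsb_val (bits n) = n.
Proof.
elim/ltn_ind: n => n IH; case: (posnP n) => [-> //|n0].
by rewrite bitsS //= IH ?odd_double_half //; lia.
Qed.

Lemma tree_size_bits l : (size l).*2 < tree_size (enc_seq enc_bool l) <= 4 * size l + 1.
Proof. by elim: l => //= -[] l; rewrite /= ?add1n; lia. Qed.

Lemma tree_size_nat_lt n k : n < 2 ^ k -> tree_size (enc_nat n) <= 4 * k + 1.
Proof.
move=> lt_n; have /andP[_ /leq_trans] := tree_size_bits (bits n); apply.
by rewrite size_mkseq leq_add2r leq_mul2l /= up_log_min.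
Qed.

(** A digit 1 costs 4 and a digit 0 costs 2, so the size is not monotone (7 takes 13 and 8 takes
    11); the factor 2 makes up for this. *)
Lemma tree_size_nat_le m n : m <= n -> tree_size (enc_nat m) <= 2 * tree_size (enc_nat n).
Proof.
move=> le_mn; have := tree_size_bits (bits n); rewrite size_mkseq -/(enc_nat n).
have := @tree_size_nat_lt m (up_log 2 n.+1); have := up_logP n.+1 (isT : 1 < 2); lia.
Qed.

Lemma ltn_exp_tree_size n : n < 2 ^ tree_size (enc_nat n).
Proof.
have := lsb_val_lt (bits n); rewrite lsb_val_bits => /leq_trans; apply.
by rewrite leq_pexp2l //; have := tree_size_bits (bits n); rewrite /enc_nat; lia.
Qed.

Section Arithmetic.
Context {X : Type} {ex : X -> tree}.

Lemma polytime_bits f :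
  polytime ex enc_nat f -> polytime ex (enc_seq enc_bool) (fun x => bits (f x)).
Proof. by move=> pf; apply: (polytime_eq (h := id) pf). Qed.

Lemma polytime_odd f :
  polytime ex enc_nat f -> polytime ex enc_bool (fun x => odd (f x)).
Proof.
move=> /polytime_bits/(polytime_head false); apply: polytime_ext => x.
by case: (posnP (f x)) => [-> //|f0]; rewrite bitsS.
Qed.

Lemma polytime_half f :
  polytime ex enc_nat f -> polytime ex enc_nat (fun x => (f x)./2).
Proof.
move=> /polytime_bits/polytime_behead pf; apply: (polytime_eq (h := id) pf) => // x.
by rewrite /enc_nat; case: (posnP (f x)) => [-> //|f0]; rewrite (bitsS f0).
Qed.

Lemma polytime_eq0 f :
  polytime ex enc_nat f -> polytime ex enc_bool (fun x => f x == 0).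
Proof.
move=> /polytime_bits/polytime_nilp; apply: polytime_ext => x.
by case: (posnP (f x)) => [-> //|f0]; rewrite bitsS.
Qed.

Lemma polytime_addb_double (b : X -> bool) f :
  polytime ex enc_bool b -> polytime ex enc_nat f ->
  polytime ex enc_nat (fun x => b x + (f x).*2).
Proof.
move=> pb pf; have pl : polytime ex (enc_seq enc_bool)
    (* A digit is prepended, except that zero must keep the empty list of digits. *)
    (fun x => if ~~ b x && (f x == 0) then [::] else b x :: bits (f x)).
  apply: polytime_if; last exact: polytime_cons (polytime_bits pf).
    exact: polytime_and (polytime_neg pb) (polytime_eq0 pf).
  exact: polytime_const.
apply: (polytime_eq (h := id) pl) => // x.
rewrite /enc_nat; case: (posnP (f x)) => [->|f0]; first by case: (b x).
rewrite andbF bitsS; last by lia.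
by congr (enc_seq _ (_ :: bits _)); [rewrite oddD odd_double addbF; case: (b x) | lia].
Qed.

End Arithmetic.

Ltac polytime_arith :=
  lazymatch goal with
  | |- polytime _ _ (fun x => bits _) => refine (polytime_bits _)
  | |- polytime _ _ (fun x => odd _) => refine (polytime_odd _)
  | |- polytime _ _ (fun x => _./2) => refine (polytime_half _)
  | |- polytime _ _ (fun x => _ == 0) => refine (polytime_eq0 _)
  | |- polytime _ _ (fun x => nat_of_bool _ + _.*2) => refine (polytime_addb_double _ _)
  end.
Ltac polytime_extra ::= polytime_arith.

Lemma polytime_msb_val X (ex : X -> tree) l :
  polytime ex (enc_seq enc_bool) l -> polytime ex enc_nat (fun x => msb_val (l x)).
Proof.
move=> pl; apply: (polytime_rec_at (g := fun=> msb_val) (e := fun=> tt)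
  (ee := enc_unit) (step := fun p => p.1.2 + p.2.*2) (b := fun n => 4 * n + 1)
  _ _ _ _ _ _ pl).
- solve_polytime.
- solve_polytime.
- by move=> ? l' x; rewrite msb_val_rcons.
- solve_polygrowth.
- move=> e l'; apply: leq_trans (tree_size_nat_lt (msb_val_lt l')) _.
  by have := size_enc_seq enc_bool l'; lia.
- solve_polytime.
Qed.

(** Also restores the canonical form: the digits of a difference may end in zeros, which [enc_nat]
    never contains. *)
Lemma polytime_lsb_val X (ex : X -> tree) l :
  polytime ex (enc_seq enc_bool) l -> polytime ex enc_nat (fun x => lsb_val (l x)).
Proof.
move=> /polytime_rev/polytime_msb_val; apply: polytime_ext => x.
exact: msb_val_rev.
Qed.

(** A state is what remains of the subtrahend, together with the borrow. *)
Definition borrow_step (s : nat * bool) (x : bool) : (nat * bool) * option bool :=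
  ((s.1./2, if x then odd s.1 && s.2 else odd s.1 || s.2),
   Some (x (+) odd s.1 (+) s.2)).

(** Loop invariant of schoolbook subtraction: whatever the final state still has to subtract stands
    at position [size l]. *)
Lemma borrow_stepP s l :
  lsb_val l + 2 ^ size l * ((final_state borrow_step s l).1 +
                            (final_state borrow_step s l).2)
    = s.1 + s.2 + lsb_val (transduce borrow_step s l).
Proof.
elim: l s => [|x l IH] [b c] /=; first by lia.
have E := odd_double_half b; rewrite expnS.
have := IH (b./2, if x then odd b && c else odd b || c); rewrite /final_state /=.
by case: x; case: (odd b) E => /= E; case: c => /=; lia.
Qed.

Lemma size_borrow s l : size (transduce borrow_step s l) = size l.
Proof. by elim: l s => //= x l IH s; rewrite IH. Qed.

(** The output is below [2 ^ size (bits m)], so by the invariant anything left in the final state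
    forces [m < n], where truncated subtraction gives 0. *)
Lemma borrow_subE m n (r := final_state borrow_step (n, false) (bits m)) :
  m - n = if (r.1 == 0) && ~~ r.2
          then lsb_val (transduce borrow_step (n, false) (bits m)) else 0.
Proof.
have := borrow_stepP (n, false) (bits m); rewrite -/r lsb_val_bits /= addn0.
have := lsb_val_lt (transduce borrow_step (n, false) (bits m)).
rewrite size_borrow; case: eqP => [->|]; case: (r.2) => /=; nia.
Qed.

Lemma polytime_sub X (ex : X -> tree) f g :
  polytime ex enc_nat f -> polytime ex enc_nat g ->
  polytime ex enc_nat (fun x => f x - g x).
Proof.
move=> pf pg.
have pt : polytime ex (enc_pair (enc_pair enc_nat enc_bool) (enc_seq enc_bool))
    (fun x => (final_state borrow_step (g x, false) (bits (f x)),
               transduce borrow_step (g x, false) (bits (f x)))).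
  apply: (polytime_transduce_state (b := fun n => 2 * n + 3)).
  - rewrite /borrow_step; solve_polytime.
  - solve_polygrowth.
  - move=> s l; have le3 (b : bool) : tree_size (enc_bool b) <= 3 by case: b.
    suff : tree_size (enc_nat (final_state borrow_step s l).1) <=
        2 * tree_size (enc_nat s.1).
      by have := le3 (final_state borrow_step s l).2; rewrite /=; lia.
    apply: tree_size_nat_le; elim: l s => //= x l IH s.
    by apply: leq_trans (IH _) _; rewrite /=; lia.
  - solve_polytime.
  - solve_polytime.
have ps := polytime_fst pt; have pc := polytime_and
  (polytime_eq0 (polytime_fst ps)) (polytime_neg (polytime_snd ps)).
apply: polytime_ext
  (polytime_if pc (polytime_lsb_val (polytime_snd pt)) (polytime_const _ _ 0)).
by move=> x; rewrite [RHS]borrow_subE.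
Qed.

Lemma polytime_minn X (ex : X -> tree) f g :
  polytime ex enc_nat f -> polytime ex enc_nat g ->
  polytime ex enc_nat (fun x => minn (f x) (g x)).
Proof.
move=> pf pg; apply: polytime_ext (polytime_sub pf (polytime_sub pf pg)) => x.
by lia.
Qed.

(** The exponent is given in unary, as the length of a list, which keeps the result of linear
    size. *)
Lemma polytime_shift X B (ex : X -> tree) (eb : B -> tree) f l :
  polytime ex enc_nat f -> polytime ex (enc_seq eb) l ->
  polytime ex enc_nat (fun x => f x * 2 ^ size (l x)).
Proof.
move=> pf pl; apply: (polytime_rec_at (g := fun n l => n * 2 ^ size l)
  (step := fun p => false + p.2.*2) (b := fun n => 4 * n + 1)
  _ _ _ _ _ pf pl).
- by apply: polytime_ext (polytime_id _) => n; rewrite /= muln1.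
- solve_polytime.
- by move=> n l' x; rewrite size_rcons expnS mulnCA mul2n.
- solve_polygrowth.
- move=> n l'; apply: leq_trans (tree_size_nat_lt (k := tree_size (enc_nat n) + size l') _) _.
    by rewrite expnD ltn_pmul2r ?expn_gt0 // ltn_exp_tree_size.
  by have := size_enc_seq eb l'; lia.
Qed.

(* [a + b = M - ((M - a) - b)] for [M = 2^|a| 2^|b|], which spares an adder. *)
Lemma polytime_addn X (ex : X -> tree) f g :
  polytime ex enc_nat f -> polytime ex enc_nat g ->
  polytime ex enc_nat (fun x => f x + g x).
Proof.
move=> pf pg; pose M x := 1 * 2 ^ size (bits (f x)) * 2 ^ size (bits (g x)).
have pM : polytime ex enc_nat M.
  by do 2!apply: polytime_shift (polytime_bits _) => //; exact: polytime_const.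
apply: polytime_ext (polytime_sub pM (polytime_sub (polytime_sub pM pf) pg)) => x.
suff : f x + g x <= M x by lia.
have := lsb_val_lt (bits (f x)); have := lsb_val_lt (bits (g x)).
by rewrite !lsb_val_bits /M; nia.
Qed.

(** Shift-and-add multiplication, the digits of the multiplier being read from the most significant
    one. *)
Definition horner_mul (m : nat) (l : seq bool) : nat :=
  foldl (fun n (b : bool) => n.*2 + (if b then m else 0)) 0 l.

Lemma horner_mulE m l : horner_mul m l = m * msb_val l.
Proof.
elim/last_ind: l => [|l b IH]; first by rewrite muln0.
by rewrite /horner_mul foldl_rcons -/(horner_mul m l) IH msb_val_rcons; case: b; lia.
Qed.

Lemma polytime_muln X (ex : X -> tree) f g :
  polytime ex enc_nat f -> polytime ex enc_nat g ->
  polytime ex enc_nat (fun x => f x * g x).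
Proof.
move=> pf pg.
suff : polytime ex enc_nat (fun x => horner_mul (f x) (rev (bits (g x)))).
  by apply: polytime_ext => x; rewrite horner_mulE msb_val_rev lsb_val_bits.
apply: (polytime_rec_at (g := horner_mul)
  (step := fun p => (false + p.2.*2) + (if p.1.2 then p.1.1 else 0))
  (b := fun n => 4 * n + 1) _ _ _ _ _ pf (polytime_rev (polytime_bits pg))).
- solve_polytime.
- by apply: polytime_addn; solve_polytime.
- by move=> m l b; rewrite /horner_mul foldl_rcons.
- solve_polygrowth.
- move=> m l; rewrite horner_mulE.
  apply: leq_trans (tree_size_nat_lt (k := tree_size (enc_nat m) + size l) _) _.
    by rewrite expnD ltn_mul ?msb_val_lt ?ltn_exp_tree_size.
  by have := size_enc_seq enc_bool l; lia.
Qed.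

(** * The local-ratio argument *)

Lemma giso_sym G H : giso G H -> giso H G.
Proof.
by case=> f [g fK gK] fE; exists g => [|x y]; [exists f | rewrite -fE !gK].
Qed.

Lemma giso_trans G H K : giso G H -> giso H K -> giso G K.
Proof.
case=> f bf fE [g bg gE]; exists (g \o f) => [|x y]; first exact: bij_comp.
by rewrite /= gE fE.
Qed.

Lemma in_class_giso F G H : giso G H -> in_class F H -> in_class F G.
Proof. by move=> iGH [K FK iHK]; exists K => //; exact: giso_trans iGH iHK. Qed.

Lemma card_induced (G : sgraph) (S : {set G}) : #|induced S| = #|S|.
Proof. by rewrite card_sig; apply: eq_card. Qed.

Lemma giso_imset (G H : sgraph) (f : G -> H) (S : {set G}) :
  injective f -> (forall x y, edge (f x) (f y) = edge x y) ->
  giso (induced S) (induced (f @: S)).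
Proof.
move=> inj_f fE.
pose h (x : induced S) : induced (f @: S) := exist _ (f (val x)) (imset_f f (valP x)).
exists h => [|x y]; last exact: fE.
apply: inj_card_bij; last by rewrite !card_induced card_imset.
by move=> x y [] /inj_f/val_inj.
Qed.

Lemma giso_induced_val (G : sgraph) (S : {set G}) (T : {set induced S}) :
  giso (induced T) (induced (val @: T)).
Proof. by apply: (@giso_imset (induced S) G val); first exact: val_inj. Qed.

Lemma giso_sub (G : sgraph) (T S : {set G}) : T \subset S ->
  giso (induced [set x : induced S | val x \in T]) (induced T).
Proof.
move=> sTS; set U := [set x | _].
suff -> : T = val @: U by exact: giso_induced_val.
apply/setP=> x; apply/idP/imsetP => [xT|[y + ->]]; last by rewrite inE.
by exists (exist _ x (subsetP sTS x xT)); rewrite ?inE.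
Qed.

Lemma edgeless_inducedP (G : sgraph) (S : {set G}) :
  reflect {in S &, forall x y, ~~ edge x y} (edgeless (induced S)).
Proof.
apply: (iffP forallP) => [H x y xS yS|H x].
  by have /forallP/(_ (exist _ y yS)) := H (exist _ x xS).
by apply/forallP=> y; exact: H (valP x) (valP y).
Qed.

Lemma vertex_coverP (G : sgraph) (X : {set G}) :
  reflect (forall x y, edge x y -> (x \in X) || (y \in X)) (vertex_cover X).
Proof.
apply: (iffP (edgeless_inducedP _)) => H x y.
  by apply: contraLR; rewrite negb_or => /andP[xX yX]; apply: H; rewrite inE.
by rewrite !inE => xX yX; apply: contra (H x y) _; rewrite negb_or xX.
Qed.

Section LocalRatio.
Variables (F : sgraph -> Prop) (alpha : nat).
Hypothesis alpha_max : forall H, F H -> independence_number H <= alpha.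

(** Membership is up to isomorphism, so [J] is carried to an independent set of the representative
    [H] in [F], where [alpha_max] applies. *)
Lemma independent_card (G : sgraph) (T J : {set G}) :
  in_class F (induced T) -> J \subset T ->
  {in J &, forall x y, ~~ edge x y} -> #|J| <= alpha.
Proof.
case=> H FH [f /bij_inj inj_f fE] sJT indJ; apply: leq_trans (alpha_max FH).
pose K : {set induced T} := [set x | val x \in J].
have -> : #|J| = #|f @: K|.
  rewrite card_imset // -(card_imset _ val_inj); congr #|pred_of_set _|.
  apply/setP=> x; apply/idP/imsetP => [xJ|[y + ->]]; last by rewrite inE.
  by exists (exist _ x (subsetP sJT x xJ)); rewrite ?inE.
apply: (@leq_bigmax_cond _ _ (fun S : {set H} => #|S|)).
apply/edgeless_inducedP=> _ _ /imsetP[x + ->] /imsetP[y + ->].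
by rewrite !inE fE; exact: indJ.
Qed.

(** A [T] disjoint from [M] would survive as an induced subgraph of [remove M]. *)
Lemma modulator_meets (G : sgraph) (T M : {set G}) :
  in_class F (induced T) -> modulator F M -> 0 < #|T :&: M|.
Proof.
move=> FT freeM; rewrite card_gt0; apply/negP => /eqP TM.
have sTM : T \subset ~: M by rewrite -disjoints_subset -setI_eq0 TM.
exact: freeM (in_class_giso (giso_sub sTM) FT).
Qed.

Lemma card_forbidden (G : sgraph) (T C M : {set G}) :
  in_class F (induced T) -> vertex_cover C -> modulator F M ->
  #|T| <= #|T :&: C| + alpha * #|T :&: M|.
Proof.
move=> FT /vertex_coverP coverC modM; rewrite -(cardsID C T) leq_add2l.
apply: leq_trans (leq_pmulr alpha (modulator_meets FT modM)).
apply: independent_card FT (subsetDl T C) _ => x y.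
by rewrite !inE => /andP[xC _] /andP[yC _]; apply/negP=> /coverC; rewrite (negPf xC) (negPf yC).
Qed.

Section Weights.
Variable G : sgraph.
Implicit Types (w : G -> nat) (T C M X : {set G}).

Definition natweight w X : nat := \sum_(x in X) w x.

Definition posset w : {set G} := [set x | 0 < w x].

(** A fold over the list in the order of [enum G], because [reduce_bits] computes exactly this
    expression. Starting at the head makes the minimum attained when [T] is nonempty; 0 is the value
    for empty [T]. *)
Definition least w T : nat :=
  let s := [seq w x | x <- enum G & x \in T] in foldl minn (head 0 s) s.

Definition reduce w T (x : G) : nat := if x \in T then w x - least w T else w x.

Lemma foldl_minn_le a s : foldl minn a s <= a.
Proof. by elim: s a => //= x s IH a; apply: leq_trans (IH _) (geq_minl _ _). Qed.

Lemma foldl_minn_le_mem a s x : x \in s -> foldl minn a s <= x.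
Proof.
elim: s a => //= y s IH a; rewrite inE => /orP[/eqP ->|]; last exact: IH.
by apply: leq_trans (foldl_minn_le _ _) (geq_minr _ _).
Qed.

Lemma foldl_minn_mem a s : foldl minn a s \in a :: s.
Proof.
elim: s a => [|y s IH] a; first by rewrite mem_head.
have := IH (minn a y); rewrite /= !inE => /orP[/eqP ->|->]; rewrite ?orbT //.
by case: leqP => _; rewrite eqxx ?orbT.
Qed.

Lemma least_le w T x : x \in T -> least w T <= w x.
Proof.
by move=> xT; apply/foldl_minn_le_mem/map_f; rewrite mem_filter xT mem_enum.
Qed.

Lemma least_attained w T : 0 < #|T| -> exists2 x, x \in T & w x = least w T.
Proof.
case/card_gt0P=> z zT; rewrite /least; set s := map _ _.
have zs : w z \in s by apply/map_f; rewrite mem_filter zT mem_enum.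
have : foldl minn (head 0 s) s \in s.
  have := foldl_minn_mem (head 0 s) s; rewrite inE => /orP[/eqP ->|//].
  by case: s zs => // y s' _; rewrite mem_head.
case/mapP=> x; rewrite mem_filter => /andP[xT _] ->.
by exists x.
Qed.

Lemma natweight_reduce w T X :
  natweight w X = natweight (reduce w T) X + least w T * #|T :&: X|.
Proof.
have -> : least w T * #|T :&: X| = \sum_(x in X) if x \in T then least w T else 0.
  rewrite mulnC -sum_nat_const -big_mkcondr.
  by apply: eq_bigl => x; rewrite inE andbC.
rewrite /natweight -big_split; apply: eq_bigr => x _ /=; rewrite /reduce.
by case: ifP => [xT|]; rewrite ?addn0 // subnK // least_le.
Qed.

Lemma local_ratio w T C M X :
  in_class F (induced T) -> vertex_cover C -> modulator F M ->
  natweight (reduce w T) X <= natweight (reduce w T) C + alpha * natweight (reduce w T) M ->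
  natweight w X <= natweight w C + alpha * natweight w M.
Proof.
move=> FT coverC modM; rewrite !(natweight_reduce w T).
have : least w T * #|T :&: X| <= least w T * (#|T :&: C| + alpha * #|T :&: M|).
  rewrite leq_mul2l; apply/orP; right.
  exact: leq_trans (subset_leq_card (subsetIl T X)) (card_forbidden FT coverC modM).
by rewrite !mulnDr; lia.
Qed.

Lemma posset_reduce w T : T \subset posset w -> 0 < #|T| ->
  #|posset (reduce w T)| < #|posset w|.
Proof.
move=> sTw /(least_attained w)[x xT wx]; apply/proper_card/properP; split.
  by apply/subsetP=> y; rewrite !inE /reduce; case: ifP => // _; lia.
by exists x; [exact: subsetP xT | rewrite inE /reduce xT wx subnn].
Qed.

End Weights.

Variable find : forall G : sgraph, option {set G}.
Hypothesis findP : forall G : sgraph,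
  if find G is Some T then in_class F (induced T) else is_free F G.
Hypothesis nonempty : forall H : sgraph, F H -> 0 < #|H|.

Lemma in_class_card (G : sgraph) (T : {set G}) : in_class F (induced T) -> 0 < #|T|.
Proof.
by case=> H /nonempty H0 [f /bij_eq_card cardH _]; rewrite -(card_induced T) cardH.
Qed.

Section Iteration.
Variable G : sgraph.
Implicit Types w : G -> nat.

Definition forbidden w : option {set G} :=
  omap (fun S : {set induced (posset w)} => val @: S) (find (induced (posset w))).

Definition round w : G -> nat :=
  if forbidden w is Some T then reduce w T else w.

Variant forbidden_spec w : option {set G} -> Prop :=
| Forbidden T of in_class F (induced T) & T \subset posset w :
    forbidden_spec w (Some T)
| NoForbidden of is_free F (induced (posset w)) : forbidden_spec w None.

Lemma forbiddenP w : forbidden_spec w (forbidden w).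
Proof.
rewrite /forbidden; case: (find _) (findP (induced (posset w))) => [S FS|free].
  constructor; first exact: in_class_giso (giso_sym (giso_induced_val S)) FS.
  by apply/subsetP=> _ /imsetP[x _ ->]; exact: valP x.
by constructor.
Qed.

Lemma round_le w x : round w x <= w x.
Proof.
by rewrite /round /reduce; case: (forbidden w) => // T; case: ifP => //; rewrite leq_subr.
Qed.

Lemma iter_round_le n w x : iter n round w x <= w x.
Proof. by elim: n => //= n; apply: leq_trans; exact: round_le. Qed.

Lemma iter_round_free w : is_free F (induced (posset (iter #|G| round w))).
Proof.
(* Until the positive part is F-free each round loses a positive vertex; once it is, the rounds
   stand still. *)
have shrink n : is_free F (induced (posset (iter n round w))) \/
    #|posset (iter n round w)| + n <= #|G|.
  elim: n => [|n IH]; first by right; rewrite addn0 max_card.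
  rewrite iterS; set v := iter n round w in IH *; rewrite /round.
  case: forbiddenP => [T FT sT|free]; last by left.
  right; case: IH => [free|]; last by have := posset_reduce sT (in_class_card FT); lia.
  by case: (free [set y | val y \in T]); apply: in_class_giso FT; exact: giso_sub.
case: (shrink #|G|) => // card0.
(* No positive vertex is left here, whereas a forbidden set is nonempty. *)
case: (forbiddenP (iter #|G| round w)) => // T FT sT.
by have := in_class_card FT; have := subset_leq_card sT; lia.
Qed.

(** Optimality against [C] under the last weights is weakened by adding the modulator term;
    [local_ratio] then carries the inequality back through the rounds one at a time. *)
Lemma iter_round_ratio n w (C M X : {set G}) :
  vertex_cover C -> modulator F M ->
  natweight (iter n round w) X <= natweight (iter n round w) C ->
  natweight w X <= natweight w C + alpha * natweight w M.
Proof.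
move=> coverC modM opt; have := leq_trans opt (leq_addr (alpha * natweight (iter n round w) M) _).
elim: n {opt} => //= n IH le_n; apply: IH; move: le_n; rewrite /round.
case: forbiddenP => // T FT _; exact: local_ratio.
Qed.

End Iteration.
End LocalRatio.

(** * The algorithm on encoded graphs *)

Notation enc_bits := (enc_seq enc_bool).
Notation enc_adj := (enc_seq (enc_seq enc_bool)).

Ltac polytime_extra ::=
  first
    [ polytime_arith
    | lazymatch goal with
      | |- polytime _ _ (fun x => minn _ _) => refine (polytime_minn _ _)
      | |- polytime _ _ (fun x => _ - _) => refine (polytime_sub _ _)
      | |- polytime _ _ (fun x => _ + _) => refine (polytime_addn _ _)
      | |- polytime _ _ (fun x => _ * _) => refine (polytime_muln _ _)
      | |- polytime _ _ (fun x => mask _ _) => refine (polytime_mask _ _)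
      | |- polytime _ _ (fun x => rev _) => refine (polytime_rev _)
      end ].

Lemma enc_seq_map A B (e : B -> tree) (f : A -> B) (l : seq A) :
  enc_seq e (map f l) = enc_seq (fun x => e (f x)) l.
Proof. by elim: l => //= x l <-. Qed.

Definition adj (G : sgraph) : seq (seq bool) :=
  [seq [seq edge x y | y <- enum G] | x <- enum G].

Definition set_bits (G : finType) (S : {set G}) : seq bool :=
  [seq x \in S | x <- enum G].

Lemma eq_enc_seq A (e e' : A -> tree) (l : seq A) :
  e =1 e' -> enc_seq e l = enc_seq e' l.
Proof. by move=> ee'; elim: l => //= x l ->; rewrite ee'. Qed.

Lemma enc_graphE G : enc_graph G = enc_adj (adj G).
Proof. by rewrite /adj enc_seq_map; apply: eq_enc_seq => x; rewrite enc_seq_map. Qed.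

Lemma enc_setE (G : sgraph) (S : {set G}) : enc_set S = enc_bits (set_bits S).
Proof. by rewrite /set_bits enc_seq_map. Qed.

(** A subtype is enumerated in the order of the ambient type. Therefore encodings of induced
    subgraphs can be computed by masking. *)
Lemma enum_induced (G : sgraph) (S : {set G}) :
  [seq val x | x <- enum (induced S)] = mask (set_bits S) (enum G).
Proof.
have -> : enum (induced S) = pmap insub (enum G).
  by rewrite !enumT [in LHS]Finite.enum.unlock.
rewrite pmap_filter; last exact: insubK.
by rewrite /set_bits -filter_mask; apply: eq_filter => x; exact: isSome_insub.
Qed.

Lemma adj_induced (G : sgraph) (S : {set G}) :
  adj (induced S) = [seq mask (set_bits S) r | r <- mask (set_bits S) (adj G)].
Proof.
rewrite /adj -map_mask -enum_induced -!map_comp; apply: eq_map => x /=.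
by rewrite -map_mask -enum_induced -map_comp.
Qed.

Lemma tree_size_set_bits (G : sgraph) (S : {set G}) :
  tree_size (enc_bits (set_bits S)) <= 4 * tree_size (enc_graph G) + 1.
Proof.
have /andP[_ /leq_trans] := tree_size_bits (set_bits S); apply.
rewrite leq_add2r leq_mul2l /= enc_graphE; apply: leq_trans (ltnW (size_enc_seq _ _)).
by rewrite !size_map.
Qed.

Lemma expand_map d (T : Type) (P Q : T -> bool) (l : seq T) :
  expand d (map P l) [seq Q x | x <- mask (map P l) l] =
  [seq if P x then Q x else d | x <- l].
Proof. by elim: l => //= x l IH; case: (P x) => /=; rewrite IH. Qed.

(** Used twice: [d = false] brings a forbidden set of the positive part back to the graph, and
    [d = true] completes a cover of that part by all vertices of weight zero. *)
Lemma expand_set_bits d (G : sgraph) (S : {set G}) (T : {set induced S}) :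
  expand d (set_bits S) (set_bits T) =
  set_bits ((val @: T) :|: (if d then ~: S else set0)).
Proof.
have -> : set_bits T = [seq x \in val @: T | x <- mask (set_bits S) (enum G)].
  rewrite -enum_induced -map_comp; apply: eq_map => x /=.
  by rewrite mem_imset //; exact: val_inj.
rewrite expand_map; apply: eq_map => x /=; rewrite !inE.
case: ifP => xS; first by case: d; rewrite !inE ?xS orbF.
have -> : (x \in val @: T) = false.
  by apply/negP=> /imsetP[y _ Ey]; have := valP y; rewrite -Ey xS.
by case: d; rewrite !inE ?xS.
Qed.

(** * Integer-weighted graphs and the rounds on their encodings *)

Record nwgraph := NWGraph { nw_graph :> sgraph; nw : nw_graph -> nat }.

Definition nweights (N : nwgraph) : seq nat := [seq nw x | x <- enum N].

Definition enc_nwgraph (N : nwgraph) : tree :=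
  enc_pair enc_adj (enc_seq enc_nat) (adj N, nweights N).

Section NWGraph.
Context {X : Type} {ex : X -> tree}.
Variable N : X -> nwgraph.
Hypothesis pN : polytime ex enc_nwgraph N.

Lemma polytime_adj : polytime ex enc_adj (fun x => adj (N x)).
Proof.
apply: (polytime_fst (f := fun x => (adj (N x), nweights (N x)))).
exact: (polytime_eq (h := id) pN).
Qed.

Lemma polytime_nweights : polytime ex (enc_seq enc_nat) (fun x => nweights (N x)).
Proof.
apply: (polytime_snd (f := fun x => (adj (N x), nweights (N x)))).
exact: (polytime_eq (h := id) pN).
Qed.

Lemma polytime_posset_bits :
  polytime ex enc_bits (fun x => set_bits (posset (@nw (N x)))).
Proof.
apply: (polytime_ext (f := fun x => [seq ~~ (n == 0) | n <- nweights (N x)])).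
  by move=> x; rewrite -map_comp; apply: eq_map => y /=; rewrite inE lt0n.
apply: (polytime_map (f := fun (_ : unit) n => ~~ (n == 0)) (e := fun=> tt)
  (ee := enc_unit)).
- solve_polytime.
- solve_polytime.
- exact: polytime_nweights.
Qed.

Lemma polytime_induced_posset :
  polytime ex enc_graph (fun x => induced (posset (@nw (N x)))).
Proof.
have pm := polytime_posset_bits.
have pa : polytime ex enc_adj
    (fun x => [seq mask (set_bits (posset (@nw (N x)))) r |
       r <- mask (set_bits (posset (@nw (N x)))) (adj (N x))]).
  apply: (polytime_map (f := fun m (r : seq bool) => mask m r) _ pm).
    solve_polytime.
  exact: polytime_mask pm polytime_adj.
by apply: (polytime_eq (h := id) pa) => // x; rewrite enc_graphE adj_induced.
Qed.

End NWGraph.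

(** The size bound for the main loop: all later weights are compared with the initial ones, so the
    factor 2 does not compound over the rounds. *)
Lemma tree_size_nwgraph_le (G : sgraph) (v w : G -> nat) :
  (forall x, v x <= w x) ->
  tree_size (enc_nwgraph (NWGraph v)) <= 2 * tree_size (enc_nwgraph (NWGraph w)).
Proof.
move=> le_vw; rewrite /enc_nwgraph /=.
have : tree_size (enc_seq enc_nat (nweights (NWGraph v))) <=
    2 * tree_size (enc_seq enc_nat (nweights (NWGraph w))); last by lia.
rewrite /nweights; elim: (enum _) => //= x l IH.
by have := tree_size_nat_le (le_vw x); lia.
Qed.

Lemma tree_size_foldl_minn a s :
  tree_size (enc_nat (foldl minn a s)) <= 2 * tree_size (enc_nat a).
Proof. exact/tree_size_nat_le/foldl_minn_le. Qed.

Lemma polytime_foldl_minn X (ex : X -> tree) (a : X -> nat) (s : X -> seq nat) :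
  polytime ex enc_nat a -> polytime ex (enc_seq enc_nat) s ->
  polytime ex enc_nat (fun x => foldl minn (a x) (s x)).
Proof.
move=> pa ps; apply: (polytime_rec_at (g := foldl minn)
  (step := fun p => minn p.2 p.1.2) (b := fun n => 2 * n) _ _ _ _ _ pa ps).
- exact: polytime_id.
- solve_polytime.
- by move=> e l x; rewrite foldl_rcons.
- solve_polygrowth.
- by move=> e l; apply: leq_trans (tree_size_foldl_minn e l) _; lia.
Qed.

Section Loop.
Variable find : forall G : sgraph, option {set G}.
Hypothesis pfind : polytime enc_graph (enc_option enc_bits)
  (fun G => omap (@set_bits G) (find G)).

Definition nwround (N : nwgraph) : nwgraph := NWGraph (round find (@nw N)).

(** The weights after a successful round. The bits [p.2] are indexed by the vertices of the positive
    part only and must first be spread over the whole vertex list. *)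
Definition reduce_bits (p : nwgraph * seq bool) : seq nat :=
  let: s := expand false (set_bits (posset (@nw p.1))) p.2 in
  let: l := mask s (nweights p.1) in
  [seq if q.2 then q.1 - foldl minn (head 0 l) l else q.1 | q <- zip (nweights p.1) s].

Lemma nweights_round N : nweights (nwround N) =
  if omap (@set_bits _) (find (induced (posset (@nw N)))) is Some r
  then reduce_bits (N, r) else nweights N.
Proof.
rewrite /nweights /nwround /= /round /forbidden.
case: (find _) => //= T.
rewrite /reduce_bits /= expand_set_bits setU0; set U := val @: T.
rewrite /nweights -map_mask -filter_mask /set_bits zip_map -map_comp.
exact: eq_map.
Qed.

Lemma polytime_reduce_bits :
  polytime (enc_pair enc_nwgraph enc_bits) (enc_seq enc_nat) reduce_bits.
Proof.
pose s (p : nwgraph * seq bool) := expand false (set_bits (posset (@nw p.1))) p.2.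
pose l p := mask (s p) (nweights p.1).
have pN : polytime (enc_pair enc_nwgraph enc_bits) enc_nwgraph fst by solve_polytime.
have ps : polytime (enc_pair enc_nwgraph enc_bits) enc_bits s.
  by apply: polytime_expand; [exact: polytime_posset_bits | solve_polytime].
have pl : polytime (enc_pair enc_nwgraph enc_bits) (enc_seq enc_nat) l.
  exact: polytime_mask ps (polytime_nweights pN).
apply: (polytime_map (f := fun d (q : nat * bool) => if q.2 then q.1 - d else q.1)
  (e := fun p => foldl minn (head 0 (l p)) (l p))
  (ee := enc_nat) (eb := enc_pair enc_nat enc_bool)).
- solve_polytime.
- by apply: polytime_foldl_minn => //; solve_polytime.
- exact: (polytime_zip false (polytime_nweights pN) ps).
Qed.

Lemma polytime_nwround : polytime enc_nwgraph enc_nwgraph nwround.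
Proof.
have pw : polytime enc_nwgraph (enc_seq enc_nat) (fun N => nweights (nwround N)).
  apply: polytime_ext (fun N => esym (nweights_round N)) _.
  apply: (polytime_omatch (f := fun N r => reduce_bits (N, r))).
  - exact: polytime_comp pfind (polytime_induced_posset (polytime_id _)).
  - by apply: polytime_ext polytime_reduce_bits; case.
  - exact: polytime_nweights (polytime_id _).
exact: (polytime_eq (h := id) (polytime_pair (polytime_adj (polytime_id _)) pw)).
Qed.

Lemma iter_nwround n (G : sgraph) (w : G -> nat) :
  iter n nwround (NWGraph w) = NWGraph (iter n (@round find G) w).
Proof. by elim: n => //= n ->. Qed.

(** The list is a unary counter; the theorem takes the adjacency matrix, which has one row per
    vertex. *)
Lemma polytime_iter_nwround X B (ex : X -> tree) (eb : B -> tree) (N : X -> nwgraph)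
    (l : X -> seq B) :
  polytime ex enc_nwgraph N -> polytime ex (enc_seq eb) l ->
  polytime ex enc_nwgraph (fun x => iter (size (l x)) nwround (N x)).
Proof.
move=> pN pl; apply: (polytime_rec_at (g := fun N l => iter (size l) nwround N)
  (step := fun p => nwround p.2) (b := fun n => 2 * n) _ _ _ _ _ pN pl).
- exact: polytime_id.
- by apply: polytime_comp polytime_nwround _; solve_polytime.
- by move=> e l' x; rewrite size_rcons.
- solve_polygrowth.
- move=> [G w] l'; rewrite iter_nwround.
  apply: leq_trans (tree_size_nwgraph_le (iter_round_le find (size l') w)) _; lia.
Qed.

End Loop.

(** * Clearing denominators *)

Section Scaling.
Open Scope ring_scope.

(** Clearing denominators once keeps all later weights integers that never
    increase, hence of bounded size; [nscale D q] is [q * D] when the denominator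
    of [q] divides [D]. *)
Definition denprod (l : seq rat) : nat := (\prod_(q <- l) `|denq q|)%N.

Definition nscale (D : nat) (q : rat) : nat := (`|numq q| * (D %/ `|denq q|))%N.

Definition scale_seq (l : seq rat) : seq nat := [seq nscale (denprod l) q | q <- l].

Lemma nscaleE D q : 0 <= q -> (`|denq q| %| D)%N -> (nscale D q)%:R = q * D%:R.
Proof.
move=> q0 /dvdnP[e ->]; rewrite /nscale mulnK; last by rewrite absz_gt0 denq_neq0.
have {2}<- : (numq q)%:~R / (denq q)%:~R = q := divq_num_den q.
rewrite !natrM !natr_absz !ger0_norm ?denq_ge0 ?numq_ge0 //.
by rewrite [e%:R * _]mulrC -mulrA mulKf // intr_eq0 denq_neq0.
Qed.

Lemma denprod_rcons l q : denprod (rcons l q) = (denprod l * `|denq q|)%N.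
Proof. by rewrite /denprod -cats1 big_cat big_seq1. Qed.

Lemma dvdn_denprod l q : q \in l -> (`|denq q| %| denprod l)%N.
Proof.
by rewrite /denprod; elim: l => // p l IH; rewrite inE big_cons => /orP[/eqP->|/IH/dvdn_mull->];
  rewrite ?dvdn_mulr.
Qed.

Lemma denprod_gt0 l : (0 < denprod l)%N.
Proof. by apply: prodn_gt0 => q; rewrite absz_gt0 denq_neq0. Qed.

(** A new entry multiplies the common denominator, and with it all earlier values, by its own
    denominator. The quotients in [nscale] are thus computed by multiplications alone. *)
Lemma scale_seq_rcons l q : rev (scale_seq (rcons l q)) =
  (`|numq q| * denprod l)%N :: [seq (n * `|denq q|)%N | n <- rev (scale_seq l)].
Proof.
have d0 : (0 < `|denq q|)%N by rewrite absz_gt0 denq_neq0.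
rewrite /scale_seq map_rcons rev_rcons denprod_rcons /nscale mulnK // map_rev -map_comp.
congr (_ :: rev _); apply/eq_in_map => p pl /=.
by rewrite -mulnA divn_mulAC // dvdn_denprod.
Qed.

End Scaling.

Lemma tree_size_seq_le (B : eqType) (eb : B -> tree) (l : seq B) k :
  {in l, forall x, tree_size (eb x) <= k} ->
  tree_size (enc_seq eb l) <= size l * (k + 1) + 1.
Proof.
elim: l => //= x l IH le_k; have := le_k x (mem_head _ _).
have : {in l, forall y, tree_size (eb y) <= k}.
  by move=> y yl; apply: le_k; rewrite inE yl orbT.
by move/IH; lia.
Qed.

Lemma denprod_lt l : denprod l < 2 ^ tree_size (enc_seq enc_rat l).
Proof.
rewrite /denprod; elim: l => [|q l IH]; rewrite ?big_nil // big_cons /=.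
have /ltn_mul/(_ IH) := ltn_exp_tree_size `|denq q|; rewrite -expnD.
by move/leq_trans; apply; rewrite leq_pexp2l //; lia.
Qed.

Lemma numq_lt l q : q \in l -> `|numq q| < 2 ^ tree_size (enc_seq enc_rat l).
Proof.
elim: l => //= p l IH; rewrite inE => /orP[/eqP <-|/IH lt_q].
  by apply: leq_trans (ltn_exp_tree_size _) _; rewrite leq_pexp2l //; lia.
by apply: leq_trans lt_q _; rewrite leq_pexp2l //; lia.
Qed.

Lemma tree_size_scale_seq l (n := tree_size (enc_seq enc_rat l)) :
  tree_size (enc_seq enc_nat (scale_seq l)) <= n * (8 * n + 2) + 1.
Proof.
(* A numerator and the product of the denominators are both below [2 ^ n], so a scaled weight has at
   most [2 * n] digits of cost at most 4. *)
apply: leq_trans (tree_size_seq_le (k := 8 * n + 1) _) _.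
  move=> _ /mapP[q ql ->]; have -> : 8 * n = 4 * (n + n) by lia.
  apply: tree_size_nat_lt; rewrite expnD; apply: leq_ltn_trans (_ : _ <= `|numq q| * denprod l) _.
    by rewrite leq_mul2l leq_div orbT.
  by rewrite ltn_mul ?denprod_lt ?numq_lt.
have := size_enc_seq enc_rat l; rewrite size_map -/n; nia.
Qed.

Lemma polytime_numq X (ex : X -> tree) f :
  polytime ex enc_rat f -> polytime ex enc_nat (fun x => `|numq (f x)|).
Proof.
move=> pf; apply: (polytime_comp (g := fun q => `|numq q|) _ pf).
exact: polytime_left.
Qed.

Lemma polytime_denq X (ex : X -> tree) f :
  polytime ex enc_rat f -> polytime ex enc_nat (fun x => `|denq (f x)|).
Proof.
move=> pf; apply: (polytime_comp (g := fun q => `|denq q|) _ pf).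
exact: polytime_right.
Qed.

Lemma polytime_scale_seq X (ex : X -> tree) l :
  polytime ex (enc_seq enc_rat) l ->
  polytime ex (enc_seq enc_nat) (fun x => scale_seq (l x)).
Proof.
move=> pl.
have pg : polytime ex (enc_pair (enc_seq enc_nat) enc_nat)
    (fun x => (rev (scale_seq (l x)), denprod (l x))).
  apply: (polytime_rec_at (g := fun=> fun l => (rev (scale_seq l), denprod l))
    (e := fun=> tt) (ee := enc_unit)
    (step := fun p => (`|numq p.1.2| * p.2.2 :: [seq n * `|denq p.1.2| | n <- p.2.1],
                       p.2.2 * `|denq p.1.2|))
    (b := fun n => n * (8 * n + 2) + 4 * n + 4) _ _ _ _ _ _ pl).
  - apply: polytime_ext (polytime_const _ _ ([::], 1)) => e.
    by rewrite /denprod big_nil.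
  - have pq : polytime (enc_pair (enc_pair enc_unit enc_rat)
        (enc_pair (enc_seq enc_nat) enc_nat)) enc_rat (fun p => p.1.2) by solve_polytime.
    have pd := polytime_denq pq; have pn := polytime_numq pq.
    apply: polytime_pair; last by solve_polytime.
    apply: polytime_cons; first by solve_polytime.
    apply: (polytime_map (f := fun d n => n * d) _ pd); solve_polytime.
  - by move=> ? l' q; rewrite scale_seq_rcons denprod_rcons.
  - solve_polygrowth.
  - move=> e l'; rewrite /= tree_size_rev; set n := tree_size _.
    have := tree_size_scale_seq l'; have := tree_size_nat_lt (denprod_lt l').
    by rewrite -/n; nia.
  - solve_polytime.
by apply: polytime_ext (polytime_rev (polytime_fst pg)) => x; rewrite /= revK.
Qed.

Definition scale (I : wgraph) : nwgraph :=
  NWGraph (fun x : I => nscale (denprod [seq weight y | y <- enum I]) (weight x)).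

Lemma enc_wgraphE I : enc_wgraph I =
  enc_pair enc_adj (enc_seq enc_rat) (adj I, [seq weight x | x <- enum I]).
Proof. by rewrite /enc_wgraph enc_graphE /enc_pair /= enc_seq_map. Qed.

Lemma polytime_wgraph_adj : polytime enc_wgraph enc_adj (fun I => adj I).
Proof. by apply: polytime_left => I; rewrite enc_wgraphE. Qed.

Lemma polytime_scale : polytime enc_wgraph enc_nwgraph scale.
Proof.
have pw : polytime enc_wgraph (enc_seq enc_rat) (fun I => [seq weight x | x <- enum I]).
  by apply: polytime_right => I; rewrite enc_wgraphE.
apply: (polytime_eq (h := id) (polytime_pair polytime_wgraph_adj (polytime_scale_seq pw))) => //.
by move=> I; rewrite /enc_nwgraph /nweights /scale_seq /scale /= -map_comp.
Qed.

Definition positive_part (N : nwgraph) : wgraph :=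
  @WGraph (induced (posset (@nw N))) (fun x => (nw (val x))%:R%R) (fun x => ler0n _ _).

Lemma enc_rat_nat n : enc_rat n%:R%R = enc_pair enc_nat enc_nat (n, 1).
Proof. by rewrite /enc_rat -[n%:R%R]/(n%:Z%:~R)%R numq_int denq_int. Qed.

Lemma polytime_positive_part X (ex : X -> tree) N :
  polytime ex enc_nwgraph N -> polytime ex enc_wgraph (fun x => positive_part (N x)).
Proof.
move=> pN; have pw : polytime ex (enc_seq (enc_pair enc_nat enc_nat))
    (fun x => [seq (n, 1) | n <- mask (set_bits (posset (@nw (N x)))) (nweights (N x))]).
  apply: (polytime_map (f := fun (_ : unit) n => (n, 1)) (e := fun=> tt) (ee := enc_unit)).
  - solve_polytime.
  - solve_polytime.
  - exact: polytime_mask (polytime_posset_bits pN) (polytime_nweights pN).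
apply: polytime_node (polytime_induced_posset pN) pw _ => x.
rewrite /enc_wgraph /nweights -map_mask -enum_induced !enc_seq_map /=.
by congr Node; apply: eq_enc_seq => y; rewrite enc_rat_nat.
Qed.

(** Choice picks a decoded output for each instance; the domain is the subtype of the promise,
    outside of which nothing is known. The bound [b] is separate because running time does not limit
    the size of a shared output. *)
Lemma polytime_of_solvable T B (enc : T -> tree) (eb : B -> tree)
    (promise : T -> Prop) (answer : T -> tree -> Prop) (R : T -> B -> Prop)
    (b : nat -> nat) :
  poly_time_solvable enc promise answer ->
  (forall i y, answer i y -> exists2 u, y = eb u & R i u) ->
  polygrowth b -> (forall i u, R i u -> tree_size (eb u) <= b (tree_size (enc i))) ->
  exists2 f : {i | promise i} -> B,
    polytime (fun i => enc (proj1_sig i)) eb f & forall i, R (proj1_sig i) (f i).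
Proof.
case=> p [c [k H]] ansP pb bP.
have Hf (i : {i | promise i}) : {u | R (proj1_sig i) u /\ exists2 t,
    runs p (enc (proj1_sig i)) (eb u) t & t <= c * tree_size (enc (proj1_sig i)) ^ k + c}.
  apply: constructive_indefinite_description.
  have [y [t [ry le_t /ansP[u Ey Ru]]]] := H _ (proj2_sig i).
  by exists u; split=> //; exists t; rewrite // -Ey.
exists (fun i => proj1_sig (Hf i)); last by move=> i; case: (proj2_sig (Hf i)).
have [e pe eE] := polygrowth_exp k.
apply: (@Polytime _ _ _ _ _ p (fun n => c * e n + c + b n)); first by solve_polygrowth.
move=> i; have [Ru [t rt le_t]] := proj2_sig (Hf i); exists t => //.
by rewrite -eE leq_add ?bP.
Qed.

Lemma solvable_of_polytime T B (enc : T -> tree) (eb : B -> tree) (f : T -> B)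
    (answer : T -> tree -> Prop) :
  polytime enc eb f -> (forall i, answer i (eb (f i))) ->
  poly_time_solvable enc (fun=> True) answer.
Proof.
case=> p b pb H ans; have [c [k bP]] := polygrowth_leq_exp pb.
exists p, c, k => i _; have [t rt le_t] := H i; exists (eb (f i)), t; split=> //.
exact: leq_trans (leq_trans (leq_addr _ _) le_t) (bP _).
Qed.

(** The codomain in [polytime] cannot depend on the graph, so the answers are first read as lists of
    bits; a second choice recovers a set in each [G]. *)
Lemma polytime_recognition F : poly_time_recognition F ->
  exists2 find : forall G : sgraph, option {set G},
    polytime enc_graph (enc_option enc_bits) (fun G => omap (@set_bits G) (find G)) &
    forall G : sgraph, if find G is Some T then in_class F (induced T) else is_free F G.
Proof.
pose R G (r : option (seq bool)) := exists2 o : option {set vertex G},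
  r = omap (@set_bits G) o & if o is Some T then in_class F (induced T) else is_free F G.
case/(polytime_of_solvable (eb := enc_option enc_bits) (R := R)
  (b := fun n => 4 * n + 3)) => [G y [o -> oP]| |G r [o -> _]|f pf fP].
- exists (omap (@set_bits G) o); last by exists o.
  by case: o {oP} => //= T; rewrite enc_setE.
- solve_polygrowth.
- by case: o => [T|] /=; [have := tree_size_set_bits T|]; lia.
have find G : {o : option {set vertex G} | f (exist _ G I) = omap (@set_bits G) o /\
    if o is Some T then in_class F (induced T) else is_free F G}.
  apply: constructive_indefinite_description.
  by have [o Eo oP] := fP (exist _ G I); exists o.
exists (fun G => proj1_sig (find G)) => [|G]; last by case: (proj2_sig (find G)).
apply: (polytime_eq (h := fun G => exist _ G I) pf) => // G.
by case: (proj2_sig (find G)) => <-.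
Qed.

Lemma polytime_exact F : poly_time_exact_WVC F ->
  exists2 cover : forall J : {I : wgraph | is_free F I}, {set proj1_sig J},
    polytime (fun J => enc_wgraph (proj1_sig J)) enc_bits (fun J => set_bits (cover J)) &
    forall J, vertex_cover (cover J) /\ is_OPT_WVC (proj1_sig J) (set_weight (cover J)).
Proof.
pose R (I : wgraph) (r : seq bool) := exists2 X : {set I},
  r = set_bits X & vertex_cover X /\ is_OPT_WVC I (set_weight X).
case/(polytime_of_solvable (eb := enc_bits) (R := R)
  (b := fun n => 4 * n + 1)) => [I y [X [-> vX oX]]| |I r [X -> _]|f pf fP].
- by exists (set_bits X); [rewrite enc_setE | exists X].
- solve_polygrowth.
- apply: leq_trans (tree_size_set_bits X) _.
  by rewrite leq_add2r leq_mul2l /= leqW ?leq_addr.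
have cover (J : {I : wgraph | is_free F I}) : {X : {set proj1_sig J} | f J = set_bits X /\
    (vertex_cover X /\ is_OPT_WVC (proj1_sig J) (set_weight X))}.
  by apply: constructive_indefinite_description; have [X EX XP] := fP J; exists X.
exists (fun J => proj1_sig (cover J)) => [|J]; last by case: (proj2_sig (cover J)).
by apply: (polytime_eq (h := id) pf) => // J; case: (proj2_sig (cover J)) => <-.
Qed.

(** * From the positive part back to the rational instance *)

Lemma natweightS (G : sgraph) (v : G -> nat) (A B : {set G}) :
  A \subset B -> natweight v A <= natweight v B.
Proof.
move=> /subsetP sAB; rewrite /natweight !(big_mkcond (fun x => x \in _)) /=.
by apply: leq_sum => x _; case: ifP => // /sAB ->.
Qed.

Lemma natweight_posset (G : sgraph) (v : G -> nat) (A : {set G}) :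
  natweight v (A :|: ~: posset v) = natweight v A.
Proof.
rewrite /natweight big_mkcond [RHS]big_mkcond; apply: eq_bigr => x _.
by rewrite !inE -eqn0Ngt; case: (x \in A) => //=; case: eqP.
Qed.

Lemma set_weight_positive_part (N : nwgraph) (A : {set positive_part N}) :
  set_weight A = (natweight (@nw N) (val @: A))%:R%R.
Proof.
rewrite /natweight big_imset /=; last by move=> x y _ _; exact: val_inj.
by rewrite natr_sum.
Qed.

Lemma natweight_scale (I : wgraph) (A : {set I}) :
  ((natweight (@nw (scale I)) A)%:R =
    set_weight A * (denprod [seq weight y | y <- enum I])%:R)%R.
Proof.
rewrite /natweight natr_sum mulr_suml; apply: eq_bigr => x _.
by rewrite nscaleE ?weight_ge0 // dvdn_denprod // map_f ?mem_enum.
Qed.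

Section Lift.
Variables (N : nwgraph) (Y : {set positive_part N}).
Hypothesis coverY : vertex_cover Y.

Definition lift_cover : {set N} := (val @: Y) :|: ~: posset (@nw N).

Lemma lift_coverP : vertex_cover lift_cover.
Proof.
apply/vertex_coverP=> x y xy; rewrite !inE.
case xS: (0 < nw x); last by rewrite orbT.
case yS: (0 < nw y); last by rewrite !orbT.
have xP : x \in posset (@nw N) by rewrite inE.
have yP : y \in posset (@nw N) by rewrite inE.
have /vertex_coverP/(_ (exist _ x xP) (exist _ y yP) xy) := coverY.
by case/orP=> /(imset_f val) ->; rewrite ?orbT.
Qed.

(** [C] restricts to a vertex cover of the positive part that is no heavier, and the vertices added
    to [Y] are free. *)
Lemma lift_cover_opt (C : {set N}) : is_OPT_WVC (positive_part N) (set_weight Y) ->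
  vertex_cover C -> natweight (@nw N) lift_cover <= natweight (@nw N) C.
Proof.
move=> [_ optY] /vertex_coverP coverC.
pose C' : {set positive_part N} := [set y | val y \in C].
have coverC' : vertex_cover C' by apply/vertex_coverP=> x y xy; rewrite !inE coverC.
have := optY _ coverC'; rewrite !set_weight_positive_part ler_nat natweight_posset.
move/leq_trans; apply; apply: natweightS.
by apply/subsetP=> _ /imsetP[y + ->]; rewrite inE.
Qed.

End Lift.

(** Such an [H] is isomorphic to the subgraph induced by no vertices, which every graph contains;
    hence no graph is F-free and no modulator exists. *)
Lemma in_class_set0 F (G H : sgraph) :
  F H -> #|H| = 0 -> in_class F (induced (set0 : {set G})).
Proof.
move=> FH H0; exists H => //.
have absurd0 (x : induced (set0 : {set G})) : False by have := valP x; rewrite inE.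
exists (fun x => False_rect H (absurd0 x)) => [|x]; last by case: (absurd0 x).
by apply: inj_card_bij => [x|]; [case: (absurd0 x) | rewrite H0].
Qed.

Lemma vertex_cover_setT (G : sgraph) : vertex_cover [set: G].
Proof. by apply/vertex_coverP=> x y; rewrite inE. Qed.

Theorem theorem5 (F : sgraph -> Prop) (alpha : nat)
  (recognition : poly_time_recognition F)
  (alpha_max : is_max_independence F alpha)
  (exact_WVC : poly_time_exact_WVC F) :
  poly_time_solvable enc_wgraph (fun=> True)
    (fun I y => exists X : {set I},
       [/\ y = enc_set X,
           vertex_cover X &
           forall opt_wvc opt_mod : rat,
             is_OPT_WVC I opt_wvc -> is_OPT_modulator F I opt_mod ->
             (set_weight X <= opt_wvc + alpha%:R * opt_mod)%R]).
Proof.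
(* If the graph without vertices is in [F], there is no modulator, and the rounds
   need not make progress. *)
case: (classic (exists2 H, F H & #|vertex H| = 0)) => [[H FH H0]|nonempty].
  (* Any cover will do here; the full vertex set is written as one [true] per row of the adjacency
     matrix. *)
  have pT : polytime enc_wgraph enc_bits (fun I => [seq true | _ <- adj I]).
    apply: (polytime_map (f := fun (_ : unit) (_ : seq bool) => true) (e := fun=> tt)
      (ee := enc_unit) _ _ polytime_wgraph_adj); solve_polytime.
  apply: (solvable_of_polytime pT) => I; exists setT; split.
  - rewrite enc_setE /set_bits /adj -map_comp; congr enc_seq.
    by apply: eq_map => x; rewrite inE.
  - exact: vertex_cover_setT.
  - by move=> ? ? _ [[M freeM _] _]; case: (freeM set0); exact: in_class_set0 FH H0.
have {}nonempty (H : sgraph) : F H -> 0 < #|H|.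
  by rewrite lt0n => FH; apply/eqP=> H0; apply: nonempty; exists H.
have [find pfind findP] := polytime_recognition recognition.
have [cover pcover coverP] := polytime_exact exact_WVC.
pose N (I : wgraph) := NWGraph (iter #|I| (@round find I) (@nw (scale I))).
have freeN I : is_free F (positive_part (N I)) by exact: iter_round_free.
have pN : polytime enc_wgraph enc_nwgraph N.
  have := polytime_iter_nwround pfind polytime_scale polytime_wgraph_adj.
  by apply: polytime_ext => I; rewrite size_map -cardE iter_nwround.
pose J (I : wgraph) : {I : wgraph | is_free F I} := exist _ (positive_part (N I)) (freeN I).
pose Y I := cover (J I).
have pY : polytime enc_wgraph enc_bits (fun I => set_bits (Y I)).
  apply: (polytime_comp pcover (f := J)).
  exact: (polytime_eq (h := id) (polytime_positive_part pN)).
have := polytime_expand true (polytime_posset_bits pN) pY.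
move/solvable_of_polytime; apply=> I.
have [coverY optY] := coverP (J I).
exists (lift_cover (Y I)); split.
- by rewrite expand_set_bits enc_setE.
- exact: lift_coverP coverY.
(* Both optima are attained, so it suffices to compare with a cover [C] and a modulator [M] of these
   weights. *)
move=> ? ? [[C coverC <-] _] [[M modM <-] _].
have := lift_cover_opt optY coverC.
move/(iter_round_ratio (proj1 alpha_max) findP coverC modM).
(* All three integer weights are the rational ones times the same positive [denprod], which
   cancels. *)
rewrite -(ler_nat rat) natrD natrM !natweight_scale mulrA -mulrDl ler_pM2r //.
by rewrite ltr0n denprod_gt0.
Qed.
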